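(* Let $G$ be a finite group of odd order with $\Pr(G) \geq \frac{11}{75}$. Then, up to isomorphism, the quadruple $(\Pr(G),\ G',\ G' \cap Z(G),\ G/Z(G))$ is one of the following: (1) $\Pr(G)=1$, $G'=\{1\}$, $G'\cap Z(G)=\{1\}$, $G/Z(G)=\{1\}$; (2) $\Pr(G)=\frac{1}{3}\left(1+\frac{2}{3^{2s}}\right)$, $G'\cong C_3$, $G'\cap Z(G)\cong C_3$, $G/Z(G)\cong (C_3\times C_3)^s$, for some integer $s\geq 1$; (3) $\Pr(G)=\frac{1}{5}\left(1+\frac{4}{5^{2s}}\right)$, $G'\cong C_5$, $G'\cap Z(G)\cong C_5$, $G/Z(G)\cong (C_5\times C_5)^s$, for some integer $s\geq 1$; (4) $\Pr(G)=\frac{5}{21}$, $G'\cong C_7$, $G'\cap Z(G)=\{1\}$, $G/Z(G)\cong C_7\rtimes C_3$; (5) $\Pr(G)=\frac{55}{343}$, $G'\cong C_7$, $G'\cap Z(G)\cong C_7$, $G/Z(G)\cong C_7\times C_7$; (6) $\Pr(G)=\frac{17}{81}$, $G'\cong C_9$ or $G' \cong C_3\times C_3$, $G'\cap Z(G)\cong C_3$, $G/Z(G)\cong (C_3\times C_3)\rtimes C_3$; (7) $\Pr(G)=\frac{17}{81}$, $G'\cong C_3\times C_3$, $G'\cap Z(G)\cong C_3\times C_3$, $G/Z(G)\cong C_3^3$; (8) $\Pr(G)=\frac{121}{729}$, $G'\cong C_3\times C_3$, $G'\cap Z(G)\cong C_3\times C_3$, $G/Z(G)\cong C_3^4$; (9)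 $\Pr(G)=\frac{7}{39}$, $G'\cong C_{13}$, $G'\cap Z(G)=\{1\}$, $G/Z(G)\cong C_{13}\rtimes C_3$; (10) $\Pr(G)=\frac{3}{19}$, $G'\cong C_{19}$, $G'\cap Z(G)=\{1\}$, $G/Z(G)\cong C_{19}\rtimes C_3$; (11) $\Pr(G)=\frac{29}{189}$, $G'\cong C_{21}$, $G'\cap Z(G)\cong C_3$, $G/Z(G)\cong C_3\times (C_7\rtimes C_3)$; (12) $\Pr(G)=\frac{11}{75}$, $G'\cong C_5\times C_5$, $G'\cap Z(G)=\{1\}$, $G/Z(G)\cong (C_5\times C_5)\rtimes C_3$.
   Context: For a finite group $G$, $G'$ denotes the commutator subgroup, $Z(G)$ the center, and the commutativity degree is $\Pr(G)=\frac{|\{(x,y)\in G\times G : xy=yx\}|}{|G|^2}$. $C_n$ denotes the cyclic group of order $n$, $C_p^k$ the direct product of $k$ copies of $C_p$, and $(C_p\times C_p)^s$ the direct product of $s$ copies of $C_p\times C_p$. The symbol $A\rtimes B$ denotes a non-abelian semidirect product of $A$ by $B$ (these groups $G/Z(G)$ arise when $G'\not\subseteq Z(G)$). *)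

(* Defs.v *)
From HB Require Import structures.
From mathcomp Require Import all_boot all_order all_algebra all_fingroup all_solvable.
Set Implicit Arguments. Unset Strict Implicit. Unset Printing Implicit Defensive.
Import GRing.Theory Num.Theory.

Local Open Scope group_scope.

Definition comm_degree (gT : finGroupType) (G : {set gT}) : rat :=
  ((#|[set xy in setX G G | (xy.1 * xy.2 == xy.2 * xy.1)%g]|)%:R
   / ((#|G| ^ 2)%N)%:R)%R.

(* Reference groups: C_n is the additive group of 'Z_n (used only for n >= 2),
   C_p^k is the additive group of row vectors 'rV['Z_p]_k. *)
Definition Cyc (n : nat) := [set: 'Z_n].
Definition Elem (p k : nat) := [set: 'rV['Z_p]_k].

Definition is_nonab_sdprod (gT aT bT : finGroupType)
    (H : {set gT}) (A : {set aT}) (B : {set bT}) : Prop :=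
  exists K L : {group gT},
    [/\ K ><| L = H, K \isog A, L \isog B & ~~ abelian H].

Definition is_C3_x_C7sdC3 (gT : finGroupType) (H : {set gT}) : Prop :=
  exists K L : {group gT},
    [/\ K \x L = H, K \isog Cyc 3 & is_nonab_sdprod L (Cyc 7) (Cyc 3)].

(* Main.v *)
(** Write N for the derived subgroup of G and k(G) for its class number, so that
    Pr(G) = k(G) / |G| is the mean over G of 1 / |class of x|.  As |G| is odd, every
    nonlinear irreducible character has degree at least 3, so
    Pr(G) <= (1 + 8 / |N|) / 9; hence |N| <= 25, and if |N| = 25 all degrees are 1 or 3.

    If N is central, class sizes are orders of the subgroups [x, G] of N, and for each
    M of prime index p in N the centre of G / M has index an even power of p, by
    splitting off hyperbolic planes C(x) :&: C(y).  Averaging 1 / |[x, G]| then bounds or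
    determines Pr(G).

    If N is not central, let C be its centraliser; the derived subgroup of C lies in Z(G).
    If C is abelian of prime index m then |C : Z(G)| = |N|, classes outside C have
    size |N|, those in C but outside Z(G) have size m, and G / Z(G) is the split
    extension of C / Z(G) by any element outside C; so Pr(G) is explicit.  When C is not
    abelian, or when m is not 3, weighing the classes shows Pr(G) < 11 / 75.  *)

Require Import Defs.
From HB Require Import structures.
From mathcomp Require Import all_boot all_order all_algebra all_fingroup all_solvable.
From mathcomp Require Import all_field all_character ring lra zify.
Import Order.TTheory GRing.Theory Num.Theory.
Local Open Scope group_scope.
Set Implicit Arguments.
Unset Strict Implicit.
Unset Printing Implicit Defensive.

(** * Commutativity degree as a mean over class sizes *)

(** The threshold 11/75 is the value of (1 + 8 / n) / 9 at n = 25, so only odd orders of N up to 25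
    remain. Oddness enters again through automorphisms: a group of order 3 or 5 has 2 or 4 of them,
    so a normal subgroup of such an order is central. This rules out a non-central N of order 15,
    and makes the subgroup M of order 3 central when N has order 9 or 21. The exact values come from
    cases where 1 / |class of x| is a linear combination of indicators of subgroups. Elsewhere it is
    only bounded by such a combination, whose mean is again read off from indices. The margins are
    thin (35/243 and 82/567 against 11/75), so the bounds must distinguish several subgroups:
    centres modulo subgroups of N, and the centre of C. *)

Definition mean (gT : finGroupType) (G : {set gT}) (f : gT -> rat) : rat :=
  ((\sum_(x in G) f x) / #|G|%:R)%R.

(** Rational-valued, so that bounds on reciprocals of class sizes can be written as linear
    combinations of indicators and averaged by [mean_ind]. *)
Definition mem_ind (gT : finGroupType) (A : {set gT}) (x : gT) : rat :=
  ((x \in A) : nat)%:R%R.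

Section ClassMeans.
Variables (gT : finGroupType) (G : {group gT}).
Implicit Types (A B : {group gT}) (f g : gT -> rat).

Lemma cardG_rat_neq0 : (#|G|%:R != 0 :> rat)%R.
Proof. by rewrite pnatr_eq0 -lt0n cardG_gt0. Qed.

Lemma meanD f g : (mean G (fun x => f x + g x) = mean G f + mean G g)%R.
Proof. by rewrite /mean big_split mulrDl. Qed.

Lemma meanZ c f : (mean G (fun x => c * f x) = c * mean G f)%R.
Proof. by rewrite /mean -mulr_sumr mulrA. Qed.

Lemma mean_const c : mean G (fun=> c) = c.
Proof.
rewrite /mean sumr_const -[(c *+ _)%R]mulr_natr mulfK //; exact: cardG_rat_neq0.
Qed.

Lemma mean_ind A : A \subset G -> (mean G (mem_ind A) = #|G : A|%:R^-1)%R.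
Proof.
move=> sAG; rewrite /mean /mem_ind -natr_sum.
have ->: (\sum_(x in G) (x \in A : nat) = #|A|)%N.
  rewrite -big_mkcondr /= sum1dep_card; apply: eq_card => x.
  by rewrite !inE; case Ax: (x \in A); rewrite ?andbF ?(subsetP sAG).
rewrite -(Lagrange sAG) natrM invfM mulrA divff ?mul1r //.
by rewrite pnatr_eq0 -lt0n cardG_gt0.
Qed.

Lemma mean_ind2 c a A b B : A \subset G -> B \subset G ->
  (mean G (fun x => c + (a * mem_ind A x + b * mem_ind B x))
    = c + (a * #|G : A|%:R^-1 + b * #|G : B|%:R^-1))%R.
Proof.
move=> sA sB; rewrite (meanD (fun=> c)) (meanD (fun x => a * mem_ind A x)%R).
by rewrite (meanZ a) (meanZ b) mean_const !mean_ind.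
Qed.

Lemma eq_mean f g : {in G, f =1 g} -> mean G f = mean G g.
Proof. by move=> fg; congr (_ / _)%R; apply: eq_bigr. Qed.

Lemma mean_le f g : {in G, forall x, f x <= g x}%R -> (mean G f <= mean G g)%R.
Proof.
by move=> fg; rewrite ler_pM2r ?invr_gt0 ?ltr0n ?cardG_gt0 //; apply: ler_sum.
Qed.

(** Sorting commuting pairs by their first entry gives the sum of the centraliser orders, and each
    centraliser has order |G| over the class size. *)
Lemma comm_degreeE :
  comm_degree G = mean G (fun x => #|x ^: G|%:R^-1)%R.
Proof.
rewrite /comm_degree /mean natrX expr2 invfM mulrA; congr (_ / _)%R.
have ->: #|[set xy in setX G G | xy.1 * xy.2 == xy.2 * xy.1]|
        = (\sum_(x in G) #|'C_G[x]|)%N.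
  rewrite -sum1dep_card.
  transitivity (\sum_(xy : gT * gT | (xy.1 \in G) && (xy.2 \in 'C_G[xy.1])) 1)%N.
    apply: eq_bigl => -[x y]; rewrite in_setI in_setX -andbA /=; congr (_ && (_ && _)).
    by apply/idP/idP => [/eqP e|/cent1P e]; [apply/cent1P; rewrite /commute e | apply/eqP; rewrite e].
  rewrite -(pair_big_dep [in G] (fun x y => y \in 'C_G[x]) (fun _ _ => 1%N)) /=.
  by apply: eq_bigr => x _; rewrite sum1_card.
rewrite natr_sum mulr_suml; apply: eq_bigr => x Gx.
rewrite -(Lagrange (subsetIl G 'C[x])) index_cent1 natrM invfM mulrA divff ?mul1r //.
by rewrite pnatr_eq0 -lt0n cardG_gt0.
Qed.

Lemma comm_degree_classes : (comm_degree G = #|classes G|%:R / #|G|%:R)%R.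
Proof.
rewrite comm_degreeE /mean; congr (_ / _)%R.
rewrite -sum1_card natr_sum (partition_big (fun x => x ^: G) [in classes G]) /=;
  last by move=> x; apply: mem_classes.
apply: eq_bigr => _ /imsetP[y Gy ->].
rewrite (eq_bigr (fun=> #|y ^: G|%:R^-1)%R); last by move=> x /andP[_ /eqP->].
rewrite (eq_bigl [in y ^: G]) => [|x /=].
  rewrite sumr_const -[(_ *+ _)%R]mulr_natr mulVf // pnatr_eq0 -lt0n.
  by apply/card_gt0P; exists y; apply: class_refl.
apply/andP/idP => [[_ /eqP <-]|yGx]; first exact: class_refl.
by split; [case/imsetP: yGx => z Gz ->; rewrite groupJ | apply/eqP/class_eqP].
Qed.

Lemma odd_class x : odd #|G| -> odd #|x ^: G|.
Proof. by rewrite -index_cent1; apply/dvdn_odd/dvdn_indexg. Qed.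

(** A conjugate of x is x times a commutator, so the class lies in the coset x G'. *)
Lemma class_leq_der1 x : x \in G -> #|x ^: G| <= #|G^`(1)|.
Proof.
move=> Gx; rewrite -(card_lcoset (G^`(1))%G x) subset_leq_card //.
apply/subsetP=> _ /imsetP[y Gy ->]; rewrite mem_lcoset -commgEl.
exact: mem_commg.
Qed.

Lemma class1_center x : x \in G -> (#|x ^: G| == 1%N) = (x \in 'Z(G)).
Proof.
by move=> Gx; rewrite -index_cent1 indexg_eq1 subsetI subxx sub_cent1 inE Gx.
Qed.

Lemma class_gt2 x : odd #|G| -> x \in G -> x \notin 'Z(G) -> 2 < #|x ^: G|.
Proof.
move=> oddG Gx; rewrite -class1_center //; have := odd_class x oddG.
by case: #|_| => [|[|[|]]].
Qed.

End ClassMeans.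

(** * The character degree bound *)

Section DegreeBound.
Variables (gT : finGroupType) (G : {group gT}).

Definition irrdeg (i : Iirr G) : nat := irr_degree (socle_of_Iirr i).

Lemma lin_irrdeg (i : Iirr G) : (('chi_i)%R \is a linear_char) = (irrdeg i == 1%N).
Proof. by rewrite qualifE /= irr_char irr1_degree pnatr_eq1. Qed.

Lemma odd_irrdeg i : odd #|G| -> odd (irrdeg i).
Proof.
apply: dvdn_odd; have := dvd_irr1_cardG i.
by rewrite irr1_degree /= dvdC_nat.
Qed.

Lemma sum_irrdeg_sq : (\sum_i irrdeg i ^ 2)%N = #|G|.
Proof.
apply/eqP; rewrite -(eqr_nat algC) natr_sum -irr_sum_square; apply/eqP.
by apply: eq_bigr => i _; rewrite irr1_degree natrX.
Qed.

Lemma sum_nonlin : (\sum_i (irrdeg i != 1) + #|G : G^`(1)| = #|classes G|)%N.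
Proof.
rewrite -card_lin_irr -NirrE -[RHS]card_ord addnC -(cardC [pred i | irrdeg i == 1%N]).
congr (_ + _)%N; first by apply: eq_card => i; rewrite !inE lin_irrdeg.
by rewrite -sum1_card [RHS]big_mkcond; apply: eq_bigr => i _; rewrite !inE; case: eqP.
Qed.

Lemma irrdeg_sq_ge i : odd #|G| -> 1 + 8 * (irrdeg i != 1%N) <= irrdeg i ^ 2.
Proof.
move=> /(odd_irrdeg i); case: (irrdeg i) => [|[|[|n]]] //= _.
by rewrite -addn3 expnS expn1; lia.
Qed.

(** Sum [irrdeg_sq_ge] over all irreducible characters: the squares add up to |G|, and exactly |G :
    G'| of the degrees equal 1. *)
Lemma classes_bound : odd #|G| -> 9 * #|classes G| <= #|G| + 8 * #|G : G^`(1)|.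
Proof.
move=> oddG; rewrite -sum_irrdeg_sq -sum_nonlin.
have : \sum_i (1 + 8 * (irrdeg i != 1%N)) <= \sum_i irrdeg i ^ 2.
  by apply: leq_sum => i _; apply: irrdeg_sq_ge.
have := sum_nonlin; rewrite -NirrE big_split /= sum1_card card_ord -big_distrr /=.
lia.
Qed.

(** In the extremal case no term of the sum has slack, whereas an odd degree above 3 contributes at
    least 25 where [irrdeg_sq_ge] counts only 9. *)
Lemma classes_bound_eq i : odd #|G| ->
  #|G| + 8 * #|G : G^`(1)| <= 9 * #|classes G| -> irrdeg i <= 3.
Proof.
move=> oddG; rewrite -sum_irrdeg_sq -sum_nonlin leqNgt => le9.
apply/negP=> deg_i; move: le9; apply/negP; rewrite -ltnNge.
have : \sum_(j | j != i) (1 + 8 * (irrdeg j != 1%N)) <= \sum_(j | j != i) irrdeg j ^ 2.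
  by apply: leq_sum => j _; apply: irrdeg_sq_ge.
have: (\sum_(j : Iirr G) 1 = \sum_j (irrdeg j != 1) + #|G : G^`(1)|)%N.
  by rewrite sum_nonlin sum1_card card_ord NirrE.
rewrite !(bigD1 i (P := predT)) //= big_split /= -!big_distrr /=.
have := odd_irrdeg i oddG; case: (irrdeg i) deg_i => [|[|[|[|n]]]] //= _ _.
rewrite -addn4 expnS expn1; lia.
Qed.

End DegreeBound.

Lemma comm_degree_der1 (gT : finGroupType) (G : {group gT}) : odd #|G| ->
  (comm_degree G <= 9%:R^-1 * (1 + 8%:R / #|(G^`(1))%g|%:R))%R.
Proof.
move=> oddG; rewrite comm_degree_classes.
have := classes_bound oddG; rewrite -(ler_nat rat) natrD !natrM.
have -> : (#|G|%:R = #|(G^`(1))%g|%:R * #|G : G^`(1)|%:R :> rat)%R.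
  by rewrite -natrM Lagrange ?der_sub.
have := cardG_gt0 G^`(1); rewrite -(ltr_nat rat).
have := indexg_gt0 G G^`(1); rewrite -(ltr_nat rat).
set a := (#|_ : _|%:R)%R; set b := (#|_|%:R)%R; set c := (#|_|%:R)%R => a0 b0 h.
rewrite ler_pdivrMr ?mulr_gt0 //.
have ->: (9%:R^-1 * (1 + 8%:R / b) * (b * a) = 9%:R^-1 * (b * a + 8%:R * a))%R.
  by field; rewrite gt_eqF.
lra.
Qed.

Lemma der1_le25 (gT : finGroupType) (G : {group gT}) : odd #|G| ->
  (11%:R / 75%:R <= comm_degree G)%R -> #|G^`(1)| <= 25.
Proof.
move=> oddG /le_trans /(_ (comm_degree_der1 oddG)).
rewrite -(ler_nat rat); have := cardG_gt0 G^`(1); rewrite -(ltr_nat rat).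
move: (#|_|%:R : rat)%R => a a0 h.
have: (a * (11%:R / 75%:R) <= a * (9%:R^-1 * (1 + 8%:R / a)))%R by rewrite ler_pM2l.
have ->: (a * (9%:R^-1 * (1 + 8%:R / a)) = 9%:R^-1 * (a + 8%:R))%R by field; rewrite ?gt_eqF.
lra.
Qed.

Lemma irrdeg_le3 (gT : finGroupType) (G : {group gT}) (i : Iirr G) : odd #|G| ->
  #|G^`(1)| = 25 -> (11%:R / 75%:R <= comm_degree G)%R -> irrdeg i <= 3.
Proof.
move=> oddG oD; rewrite comm_degree_classes => h; apply: classes_bound_eq => //.
have oG := Lagrange (der_sub 1 G); rewrite oD in oG.
move: h; rewrite -oG natrM ler_pdivlMr ?mulr_gt0 ?ltr0n ?indexg_gt0 // => h.
rewrite -(ler_nat rat) natrD !natrM; lra.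
Qed.

(** * Central derived subgroups *)

Section Central.
Variable gT : finGroupType.
Implicit Types A B C D E G H M N P : {group gT}.

Lemma center_sub_cent1 G x : x \in G -> 'Z(G) \subset 'C_G[x].
Proof. by move=> Gx; rewrite setIS // -cent_set1 centS // sub1set. Qed.

Lemma mem_der1 G x y : x \in G -> y \in G -> [~ x, y] \in G^`(1).
Proof. exact: mem_commg. Qed.

(** A translate of the class of x, since [x, g] = x^-1 x^g. When G' is central it is the subgroup
    [x, G]. *)
Definition commset G x := [set [~ x, g] | g in G].

Lemma card_commset G x : #|commset G x| = #|x ^: G|.
Proof.
rewrite -(card_lcoset _ x); congr #|pred_of_set _|; apply/setP=> y.
rewrite mem_lcoset; apply/imsetP/imsetP=> -[g Gg e]; exists g => //.
  by rewrite -[y](mulKVg x) e commgEl mulKVg.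
by rewrite e -commgEl.
Qed.

Lemma commset_group G x : G^`(1) \subset 'Z(G) -> x \in G -> group_set (commset G x).
Proof.
move=> /subsetP cD Gx; apply/group_setP; split.
  by apply/imsetP; exists 1; rewrite ?commg1.
move=> _ _ /imsetP[g Gg ->] /imsetP[h Gh ->]; apply/imsetP; exists (h * g); first exact: groupM.
rewrite commgMJ; congr (_ * _).
have /centerP[_ ch] := cD _ (mem_der1 Gx Gh).
by rewrite conjgE (ch g Gg) mulKg.
Qed.

Lemma commset_sub G x : x \in G -> commset G x \subset G^`(1).
Proof. by move=> Gx; apply/subsetP=> _ /imsetP[g Gg ->]; apply: mem_der1. Qed.

Lemma dvd_class_der1 G x : G^`(1) \subset 'Z(G) -> x \in G -> #|x ^: G| %| #|G^`(1)|.
Proof.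
move=> cD Gx; rewrite -card_commset.
exact: (@cardSg _ _ (group (commset_group cD Gx))) (commset_sub Gx).
Qed.

Lemma class_prime G x p : prime p -> #|G^`(1)| = p -> G^`(1) \subset 'Z(G) ->
  x \in G -> x \notin 'Z(G) -> #|x ^: G| = p.
Proof.
move=> pp oD cD Gx; rewrite -class1_center //.
by have := dvd_class_der1 cD Gx; rewrite oD => /(primeP pp).2 /orP[-> //|/eqP].
Qed.

Lemma expg_comm_der1 G x y n : G^`(1) \subset 'Z(G) -> x \in G -> y \in G ->
  [~ x ^+ n, y] = [~ x, y] ^+ n.
Proof.
move=> /subsetP cD Gx Gy; apply: commXg.
by have /centerP[_ cx] := cD _ (mem_der1 Gx Gy); rewrite /commute -(cx x).
Qed.

Lemma prime_indexE G H x : H \subset G -> prime #|G : H| -> x \in G -> x \notin H ->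
  H <*> <[x]> = G.
Proof.
move=> sHG /(p_index_maximal sHG) /maxgroupP[_ maxH] Gx nHx; apply/eqP.
rewrite eqEproper join_subG sHG cycle_subG Gx; apply/negP => prop.
have /= e := maxH _ prop (joing_subl _ _).
by case/negP: nHx; rewrite -e mem_gen // inE cycle_id orbT.
Qed.

Lemma prime_index_mulG G A B : A <| G -> prime #|G : A| -> B \subset G ->
  ~~ (B \subset A) -> A * B = G /\ #|B : A :&: B| = #|G : A|.
Proof.
move=> nAG pA sBG nBA; have sAG := normal_sub nAG.
have [x Bx nAx] := subsetPn nBA.
have e: A * B = G.
  apply/eqP; rewrite eqEsubset mul_subG //= -{1}(prime_indexE sAG pA (subsetP sBG x Bx) nAx).
  rewrite norm_joinEr; last by rewrite cycle_subG (subsetP (normal_norm nAG)) // (subsetP sBG).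
  by rewrite mulgS // cycle_subG.
by split=> //; rewrite setIC indexgI -e indexMg.
Qed.

(** Commutation is a nondegenerate alternating form on G / Z(G) with values in a group of order p.
    The induction on |G| passes to the orthogonal complement H of a non-commuting pair x, y, which
    has index p^2 and the same centre. *)
Lemma index_center_prime G p : prime p -> #|G^`(1)| = p -> G^`(1) \subset 'Z(G) ->
  exists2 s, 0 < s & #|G : 'Z(G)| = (p ^ (2 * s))%N.
Proof.
move=> pp; have [n] := ubnP #|G|; elim: n G => // n IHn G leGn oD cD.
have [x Gx Zx] : exists2 x, x \in G & x \notin 'Z(G).
  apply/subsetPn; apply/negP => sGZ; have: G^`(1) = 1.
    by apply/commG1P; apply: subset_trans sGZ (subsetIr _ _).
  by move=> D1; rewrite -oD D1 cards1 in pp.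
have [y Gy nxy] : exists2 y, y \in G & y \notin 'C[x].
  by apply/subsetPn; rewrite sub_cent1; apply: contra Zx; rewrite inE Gx.
have Zy: y \notin 'Z(G).
  by apply: contra nxy => /centerP[_ cy]; apply/cent1P; apply: cy.
have iGx: #|G : 'C_G[x]| = p by rewrite index_cent1 (class_prime pp).
have iGy: #|G : 'C_G[y]| = p by rewrite index_cent1 (class_prime pp).
pose Cx := 'C_G[x]%G; pose Cy := 'C_G[y]%G; pose H := (Cx :&: Cy)%G.
have nyCx: y \notin Cx by rewrite inE Gy.
have nxCy: x \notin Cy by rewrite inE Gx cent1C.
have Cxx: x \in Cx by apply: subcent1_id.
have Cyy: y \in Cy by apply: subcent1_id.
have nCz z : z \in G -> 'C_G[z] <| G.
  move=> Gz; apply: sub_der1_normal (subsetIl _ _); rewrite subsetI der_sub /=.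
  by apply/(subset_trans cD)/(subset_trans (subsetIr _ _)); rewrite -cent_set1 centS // sub1set.
have [eG iCy] : Cx * Cy = G /\ #|Cy : H| = #|G : Cx|.
  apply: prime_index_mulG => //; rewrite ?nCz ?subsetIl ?iGx //.
  by apply/subsetPn; exists y.
have [_ iCx] : Cy * Cx = G /\ #|Cx : Cy :&: Cx| = #|G : Cy|.
  apply: prime_index_mulG => //; rewrite ?nCz ?subsetIl ?iGy //.
  by apply/subsetPn; exists x.
have {}iCx : #|Cx : H| = p.
  exact: etrans (congr1 (fun X : {set gT} => #|Cx : X|) (setIC _ _)) (etrans iCx iGy).
rewrite iGx in iCy.
have iH : #|G : H| = (p ^ 2)%N.
  by rewrite -(Lagrange_index (subsetIl G 'C[x]) (subsetIl Cx Cy)) iGx iCx.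
have eCx: H <*> <[x]> = Cx.
  by apply: prime_indexE => //; rewrite ?iCx ?subsetIl // inE negb_and nxCy orbT.
have eCy: H <*> <[y]> = Cy.
  by apply: prime_indexE => //; rewrite ?iCy ?subsetIr // inE negb_and nyCx.
have sHG: H \subset G by rewrite subIset // subsetIl.
have sHCx : H \subset 'C[x] by apply: subset_trans (subsetIl _ _) (subsetIr _ _).
have sHCy : H \subset 'C[y] by apply: subset_trans (subsetIr _ _) (subsetIr _ _).
have sZH : 'Z(H) \subset H := center_sub H.
(* H, x and y generate G, and H centralises x and y, so Z(H) is central in G; conversely Z(G) lies
   in both centralisers. *)
have eZ: 'Z(H) = 'Z(G).
  apply/eqP; rewrite eqEsubset; apply/andP; split.
    rewrite subsetI (subset_trans sZH sHG) /= -[X in 'C(X)]eG centM.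
    have sC z : 'Z(H) \subset 'C[z] -> 'Z(H) \subset 'C(H <*> <[z]>).
      by move=> sZz; rewrite centY subsetI subsetIr cent_cycle.
    rewrite -[X in _ \subset 'C(X) :&: _]eCx -[X in _ \subset _ :&: 'C(X)]eCy.
    by rewrite subsetI !sC // (subset_trans sZH).
  have sZC z : z \in G -> 'Z(G) \subset 'C_G[z].
    by move=> Gz; rewrite setIS // -cent_set1 centS // sub1set.
  apply/subsetIP; split; last exact: subset_trans (subsetIr _ _) (centS sHG).
  by apply/subsetIP; split; apply: sZC.
(* An abelian H equals Z(G) and ends the induction with s = 1; otherwise H' fills the prime-order G'
   and the induction hypothesis applies to H. *)
have [H1|ntH] := eqVneq H^`(1) 1.
  exists 1%N => //; rewrite muln1 -iH -eZ; congr #|_ : _|.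
  by apply/center_idP; apply/derG1P.
have eD: H^`(1) = G^`(1).
  apply/eqP; rewrite eqEcard dergS //= oD leqNgt; apply: contra ntH => lt1.
  have := cardSg (dergS 1 sHG); rewrite oD => /(primeP pp).2.
  by rewrite trivg_card1 (ltn_eqF lt1) orbF.
have [||| s s0 es] := IHn H; rewrite ?eD //.
- rewrite -ltnS; apply: leq_trans leGn; rewrite ltnS; apply: proper_card.
  by rewrite properEneq sHG andbT; apply/eqP=> /(congr1 (fun A : {set gT} => x \in A)); rewrite Gx inE (negbTE nxCy) andbF.
- by rewrite eZ.
by exists s.+1 => //; rewrite -eZ -(Lagrange_index sHG sZH) iH es -expnD mulnS.

Qed.
End Central.

(** * Centres of quotients and centralisers of derived subgroups *)

Section Relative.
Variable gT : finGroupType.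
Implicit Types A B C D E G H M N P : {group gT}.

(** The centre of G modulo M: for normal M, the elements x with every [x, g] in M. For M inside a
    central G' this says that the subgroup [x, G] lies in M. *)
Definition relZ G M : {group gT} := (coset M @*^-1 'Z(G / M))%G.

Lemma relZ_sub G M : M <| G -> relZ G M \subset G.
Proof.
move=> nMG; apply: subset_trans (_ : coset M @*^-1 (G / M) \subset G).
  by rewrite morphpreS // subsetIl.
by rewrite quotientGK.
Qed.

Lemma relZP G M x : M <| G ->
  reflect (x \in G /\ {in G, forall g, [~ x, g] \in M}) (x \in relZ G M).
Proof.
move=> nMG; have nM := subsetP (normal_norm nMG).
apply: (iffP idP) => [Wx | [Gx cx]].
  have Gx := subsetP (relZ_sub nMG) x Wx; split=> // g Gg.
  have /centerP[_ cx] : coset M x \in 'Z(G / M) by case/morphpreP: Wx.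
  apply: coset_idr; first by rewrite groupR ?nM.
  rewrite morphR ?nM //; apply/eqP/commgP/cx; exact: mem_quotient.
rewrite inE nM //= inE; apply/centerP; split; first exact: mem_quotient.
move=> _ /morphimP[g Ng Gg ->]; apply/commgP; rewrite -morphR ?nM //.
by apply/eqP; apply: coset_id; apply: cx.
Qed.

Lemma sub_relZ G M : M \subset relZ G M.
Proof. by case/andP: (@normal_cosetpre _ M 'Z(G / M)%G). Qed.

Lemma index_relZ G M : M <| G -> #|G : relZ G M| = #|G / M : 'Z(G / M)|.
Proof.
move=> nMG; rewrite -(@index_quotient_eq _ G M (relZ G M)) ?relZ_sub ?normal_norm //.
  by rewrite /= cosetpreK.
exact: subset_trans (subsetIr _ _) (sub_relZ G M).
Qed.

Lemma dvd_class_quotient G M x : M <| G -> x \in G ->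
  #|coset M x ^: (G / M)| %| #|x ^: G|.
Proof.
move=> nMG Gx; have nM := normal_norm nMG.
rewrite -!index_cent1; apply: dvdn_trans (index_morphim (coset_morphism M) _).
  by apply: indexgS; apply: quotient_subcent1.
by rewrite subIset // nM.
Qed.

(** The quotient G / M has a central derived subgroup of order p, so its non-central classes have
    size p, and class sizes in G / M divide those in G. *)
Lemma relZ_prime G M p : prime p -> M <| G -> M \subset G^`(1) ->
  #|G^`(1) : M| = p -> [~: G^`(1), G] \subset M ->
  (exists2 s, 0 < s & #|G : relZ G M| = (p ^ (2 * s))%N)
  /\ {in G, forall x, x \notin relZ G M -> p %| #|x ^: G|}.
Proof.
move=> pp nMG sMD iD cD; have nM := normal_norm nMG.
have nMD : G^`(1) \subset 'N(M) := subset_trans (der_sub 1 G) nM.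
have oDM: #|(G / M)^`(1)| = p by rewrite -quotient_der // card_quotient.
have cDM: (G / M)^`(1) \subset 'Z(G / M).
  by rewrite subsetI der_sub -quotient_der //= quotient_cents2.
split; first by rewrite index_relZ //; apply: index_center_prime.
move=> x Gx nWx; rewrite -(class_prime pp oDM cDM (mem_quotient M Gx)) ?dvd_class_quotient //.
by apply: contra nWx => Zx; rewrite inE (subsetP nM) //= inE.
Qed.

(** G / C_G(P) embeds in Aut(P), which has order |P| - 1. *)
Lemma index_cent_prime G P : prime #|P| -> P <| G -> #|G : 'C_G(P)| %| #|P|.-1.
Proof.
move=> pP nPG.
have := cardSg (Aut_conj_aut P G).
rewrite card_morphim ker_conj_aut (setIidPr (normal_norm nPG)).
by rewrite card_Aut_cyclic ?prime_cyclic // totient_prime // indexgI.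
Qed.

(** Aut(P) is abelian because P is cyclic, so G' acts trivially on P. *)
Lemma der1_cent_prime G P : prime #|P| -> P <| G -> G^`(1) \subset 'C(P).
Proof.
move=> pP nPG; have nP := normal_norm nPG.
rewrite -ker_conj_aut ker_trivg_morphim (subset_trans (der_sub 1 G)) //= morphim_der //.
rewrite (sameP trivgP derG1P); apply: abelianS (Aut_conj_aut P G) _.
exact/Aut_cyclic_abelian/prime_cyclic.
Qed.

(** The index of C_G(P) is odd and divides 2 or 4. *)
Lemma odd_normal_35_central G P : odd #|G| -> P <| G -> (#|P| == 3) || (#|P| == 5) ->
  P \subset 'Z(G).
Proof.
move=> oddG nPG oP.
have pP: prime #|P| by case/orP: oP => /eqP->.
have := index_cent_prime pP nPG; have := dvdn_odd (dvdn_indexg G 'C_G(P)) oddG.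
rewrite subsetI normal_sub //= centsC -[G \subset _]andTb -[true](subxx G) -subsetI -indexg_eq1.
move: #|G : _| => i oi.
by case/orP: oP oi => /eqP -> /= oi di; have /(_ isT) := dvdn_leq _ di; move: i oi di => [|[|[|[|[|?]]]]].
Qed.

(** Three subgroups lemma: C = C_G(G') centralises [C, G], so [C, G, C] and [G, C, C] are trivial,
    and then so is [C, C, G]. *)
Lemma der1_cent_der1 G : ('C_G(G^`(1)))^`(1) \subset 'Z(G).
Proof.
pose C := 'C_G(G^`(1))%G; rewrite -[X in X^`(1)]/(gval C) subsetI (subset_trans (der_sub 1 C)) ?subsetIl //=.
apply/commG1P; apply: three_subgroup.
  by apply/commG1P; rewrite centsC (subset_trans (subsetIr G _)) // centS // commSg // subsetIl.
by apply/commG1P; rewrite centsC (subset_trans (subsetIr G _)) // centS // commgS // subsetIl.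
Qed.

(** Three subgroups lemma again: with W the centre of G modulo M, [W, G] lies in M and is central,
    so [W, G, G] = 1 and hence [G, G, W] = 1. *)
Lemma relZ_cent_der1 G M : M <| G -> M \subset 'Z(G) -> relZ G M \subset 'C_G(G^`(1)).
Proof.
move=> nMG cM; rewrite subsetI relZ_sub //= centsC; apply/commG1P.
have cWG : [~: relZ G M, G] \subset 'C(G).
  apply: subset_trans (subset_trans cM (subsetIr _ _)).
  by rewrite gen_subG; apply/subsetP=> _ /imset2P[w g /(relZP _ nMG)[_ cw] Gg ->]; apply: cw.
by apply: three_subgroup; apply/commG1P; rewrite // commGC.
Qed.

End Relative.

(** * Abelian normal subgroups of prime index *)

Section AbelianPrimeIndex.
Variables (gT : finGroupType) (G A : {group gT}).
Hypotheses (nAG : A <| G) (cAA : abelian A) (pA : prime #|G : A|) (ncG : ~~ abelian G).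

Let sAG : A \subset G := normal_sub nAG.

Lemma center_sub_abelian_prime_index : 'Z(G) \subset A.
Proof.
apply/subsetP=> z Zz; apply: contraR ncG => nAz.
have /centerP[Gz cz] := Zz.
rewrite -(prime_indexE sAG pA Gz nAz) abelianY cAA cycle_abelian /=.
rewrite cycle_subG; apply/centP=> a Aa; apply: cz; exact: subsetP sAG a Aa.
Qed.

Lemma cent1_abelian_prime_index x : x \in G -> x \notin A -> 'C_A[x] = 'Z(G).
Proof.
move=> Gx nAx; apply/eqP; rewrite eqEsubset andbC; apply/andP; split.
  rewrite subsetI center_sub_abelian_prime_index (subset_trans (subsetIr _ _)) //.
  by rewrite -cent_set1 centS // sub1set.
rewrite subsetI (subset_trans (subsetIl _ _)) //= -[X in 'C(X)](prime_indexE sAG pA Gx nAx).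
by rewrite centY cent_cycle subsetI subsetIr (subset_trans (subsetIl _ _)).
Qed.

(** G is the product of A and C_G(x), so A is transitive on the class, with stabiliser C_A(x) =
    Z(G). *)
Lemma class_out_abelian_prime_index x : x \in G -> x \notin A ->
  #|x ^: G| = #|A : 'Z(G)|.
Proof.
move=> Gx nAx; have [|_] := prime_index_mulG nAG pA (subsetIl G 'C[x]).
  by apply/subsetPn; exists x => //; apply: subcent1_id.
rewrite setIA (setIidPl sAG) cent1_abelian_prime_index // => e.
have sZ: 'Z(G) \subset 'C_G[x] by exact: center_sub_cent1.
apply/eqP; rewrite -index_cent1 -(eqn_pmul2r (prime_gt0 pA)) -{1}e Lagrange_index ?subsetIl //.
by rewrite mulnC Lagrange_index // center_sub_abelian_prime_index.
Qed.

(** C_G(x) contains the maximal subgroup A and is not all of G. *)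
Lemma class_in_abelian_prime_index x : x \in A -> x \notin 'Z(G) ->
  #|x ^: G| = #|G : A|.
Proof.
move=> Ax nZx; rewrite -index_cent1; congr #|_ : _|.
have Gx := subsetP sAG x Ax.
have sAC : A \subset 'C_G[x] by rewrite subsetI sAG sub_cent1 (subsetP cAA).
have /maxgroupP[_ maxA] := p_index_maximal sAG pA.
apply: (maxA 'C_G[x]%G) => //; rewrite properEneq subsetIl andbT.
by apply: contra nZx => /eqP /setIidPl; rewrite sub_cent1 inE Gx.
Qed.

Lemma exists_out_prime_index : exists2 x, x \in G & x \notin A.
Proof. by apply/subsetPn; rewrite -indexg_gt1 prime_gt1. Qed.

(** For x outside A the class has size |A : Z(G)|, at most |G'|. Conversely a -> [a, x] is
    multiplicative on the abelian A; its image R is normal with abelian quotient, so it contains G',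
    and R has at most as many elements as the class of x. *)
Lemma index_center_abelian_prime_index : #|A : 'Z(G)| = #|G^`(1)|.
Proof.
have [x Gx nAx] := exists_out_prime_index.
rewrite -(class_out_abelian_prime_index Gx nAx).
apply/eqP; rewrite eqn_leq class_leq_der1 //=.
pose R := [set [~ a, x] | a in A].
have nAx' : x \in 'N(A) := subsetP (normal_norm nAG) x Gx.
have sRA : R \subset A by apply/subsetP=> _ /imsetP[a Aa ->]; rewrite commgEl groupM ?groupV ?memJ_norm.
have gR : group_set R.
  apply/group_setP; split; first by apply/imsetP; exists 1; rewrite ?group1 ?comm1g.
  move=> _ _ /imsetP[a Aa ->] /imsetP[b Ab ->]; apply/imsetP; exists (a * b); first exact: groupM.
  rewrite commMgJ conjgE; congr (_ * _).
  have Rax : [~ a, x] \in A by apply: (subsetP sRA); apply: imset_f.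
  by rewrite (centsP cAA _ Rax _ Ab) mulKg.
have nRG : G \subset 'N(R).
  rewrite -(prime_indexE sAG pA Gx nAx) join_subG cycle_subG; apply/andP; split.
    by apply: cents_norm; apply: subset_trans cAA _; apply: centS.
  rewrite inE; apply/subsetP=> _ /imsetP[_ /imsetP[a Aa ->] ->].
  by apply/imsetP; exists (a ^ x); rewrite ?memJ_norm // conjRg [x ^ x]conjgE mulKg.
(* G / R is generated by the abelian image of A and the image of x, which commute because every
   [a, x] lies in R. *)
have sDR: G^`(1) \subset R.
  pose Rg := group gR; have {}nRG : G \subset 'N(Rg) by [].
  apply: (@der1_min _ G Rg) => //.
  have nRx : <[x]> \subset 'N(Rg) by rewrite cycle_subG (subsetP nRG).
  rewrite -(prime_indexE sAG pA Gx nAx) quotientY ?(subset_trans sAG nRG) //.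
  rewrite abelianY !quotient_abelian ?cycle_abelian ?andTb //.
  rewrite quotient_cycle ?(subsetP nRG) // cycle_subG.
  apply/centP=> _ /morphimP[a Na Aa ->]; apply/commute_sym/commgP.
  have nx : x \in 'N(Rg) by apply: subsetP nRG x Gx.
  by rewrite -morphR //= coset_id //; apply: imset_f.
apply: leq_trans (subset_leq_card sDR) _.
rewrite -card_commset -[X in X <= _](card_imset (mem R) invg_inj); apply: subset_leq_card.
apply/subsetP=> _ /imsetP[_ /imsetP[a Aa ->] ->]; rewrite invgR.
by apply/imsetP; exists a => //; apply: subsetP sAG a Aa.
Qed.

(** Class sizes are 1 on Z(G), m on the rest of A and n elsewhere; the subgroups have indices m n, m
    and 1, and the coefficients are the successive increments of 1/n, 1/m, 1. *)
Lemma comm_degree_abelian_prime_index (n := (#|(G^`(1))%g|%:R : rat)%R) (m := (#|G : A|%:R : rat)%R) :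
  (comm_degree G = n^-1 + (m^-1 - n^-1) / m + (1 - m^-1) / (m * n))%R.
Proof.
have sZA := center_sub_abelian_prime_index; have sZG := center_sub G.
rewrite comm_degreeE (@eq_mean _ _ _ (fun x => n^-1 +
  ((m^-1 - n^-1) * mem_ind A x + (1 - m^-1) * mem_ind 'Z(G) x))%R); last first.
  move=> x Gx; rewrite /mem_ind; have [Ax|nAx] := boolP (x \in A); last first.
    rewrite (class_out_abelian_prime_index Gx nAx) index_center_abelian_prime_index.
    by rewrite (contraNF (subsetP sZA x) nAx) -/n !mulr0 !addr0.
  have [Zx|nZx] := boolP (x \in 'Z(G)).
    have /eqP-> : #|x ^: G| == 1%N by rewrite class1_center.
    rewrite invr1 /=; ring.
  rewrite class_in_abelian_prime_index //= -/m; ring.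
rewrite mean_ind2 // -(Lagrange_index sAG sZA).
by rewrite index_center_abelian_prime_index natrM -/m -/n addrA.
Qed.

(** The power x^m lies in A and commutes with x, so it lies in C_A(x) = Z(G); the image of x
    therefore has order m and generates a complement. *)
Lemma quotient_center_sdprod x : x \in G -> x \notin A ->
  (A / 'Z(G)) ><| <[coset 'Z(G) x]> = G / 'Z(G) /\ #[coset 'Z(G) x] = #|G : A|.
Proof.
move=> Gx nAx; set m := #|G : A|.
have sZA := center_sub_abelian_prime_index.
have nZG : G \subset 'N('Z(G)) := normal_norm (center_normal G).
have nZx := subsetP nZG x Gx.
have nZA := subset_trans sAG nZG.
have nAx' : x \in 'N(A) := subsetP (normal_norm nAG) x Gx.
have Axm : x ^+ m \in A.
  apply: coset_idr; first by rewrite groupX.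
  by rewrite morphX // /m -card_quotient ?normal_norm // expg_cardG ?mem_quotient.
have Zxm : x ^+ m \in 'Z(G).
  by rewrite -(cent1_abelian_prime_index Gx nAx) inE Axm; apply/cent1P; apply: commute_sym; apply: commuteX.
have nAbx: coset 'Z(G) x \notin A / 'Z(G).
  apply: contra nAx => Abx; rewrite -(quotientGK (normalS sZA sAG (center_normal G))).
  by rewrite inE nZx inE.
have ox : #[coset 'Z(G) x] = m.
  have : #[coset 'Z(G) x] %| m.
    by rewrite order_dvdn -morphX //; apply/eqP; apply: coset_id.
  case/primeP: pA => _ /[apply] /orP[|/eqP //]; rewrite order_eq1 => /eqP e.
  by rewrite e group1 in nAbx.
split=> //.
have ti : A / 'Z(G) :&: <[coset 'Z(G) x]> = 1.
  by rewrite setIC; apply: prime_TIg; rewrite -?orderE ?ox // cycle_subG.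
have nA : <[coset 'Z(G) x]> \subset 'N(A / 'Z(G)).
  rewrite cycle_subG; apply: (subsetP (_ : G / 'Z(G) \subset _)); last exact: mem_quotient.
  exact: quotient_norms (normal_norm nAG).
rewrite sdprodEY // [LHS]/=.
have <- : <[x]> / 'Z(G) = <[coset 'Z(G) x]> by apply: quotient_cycle.
rewrite -quotientY ?cycle_subG //=.
by rewrite (prime_indexE sAG pA Gx nAx).
Qed.

End AbelianPrimeIndex.

(** * Central derived subgroup: prime order and order 3q *)

Lemma card_Cyc n : 1 < n -> #|Cyc n| = n.
Proof. by move=> n1; rewrite cardsT card_ord Zp_cast. Qed.

Lemma isog_Cyc (gT : finGroupType) (H : {group gT}) n :
  1 < n -> cyclic H -> #|H| = n -> H \isog Cyc n.
Proof.
move=> n1 cH oH; rewrite (isog_cyclic_card [set: 'Z_n]%G cH) /= card_Cyc // oH eqxx andbT.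
by apply/cyclicP; exists Zp1; rewrite -Zp_cycle.
Qed.

Lemma isog_Cyc_prime (gT : finGroupType) (H : {group gT}) p :
  prime p -> #|H| = p -> H \isog Cyc p.
Proof. by move=> pp oH; apply: isog_Cyc; rewrite ?prime_gt1 ?prime_cyclic ?oH. Qed.

Lemma isog_Elem (gT : finGroupType) (H : {group gT}) p k :
  prime p -> p.-abelem H -> #|H| = (p ^ k)%N -> H \isog Elem p k.
Proof.
move=> pp aH oH; have p1 := prime_gt1 pp.
rewrite (isog_abelem_card [set: 'rV['Z_p]_k]%G aH) oH /= cardsT card_mx card_ord mul1n Zp_cast //.
rewrite eqxx andbT; apply: (@fin_lmod_pchar_abelem p 'Z_p).
by rewrite inE pp pchar_Zp /=.
Qed.

Lemma ler_inv_nat (a b : nat) : 0 < b -> b <= a -> (a%:R^-1 <= b%:R^-1 :> rat)%R.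
Proof.
by move=> b0 ab; rewrite lef_pV2 ?ler_nat // posrE ltr0n // (leq_trans b0).
Qed.

Section CentralCases.
Variables (gT : finGroupType) (G : {group gT}).
Implicit Types M P N : {group gT}.
Hypotheses (cD : G^`(1) \subset 'Z(G)).

(** As commutators are central, [x^p, y] = [x, y]^p = 1, so p-th powers are central. *)
Lemma quotient_center_abelem p : prime p -> {in G^`(1), forall z, z ^+ p = 1} ->
  p.-abelem (G / 'Z(G)).
Proof.
move=> pp Dp; have nZ := subsetP (normal_norm (center_normal G)).
apply/abelemP => //; split; first exact: sub_der1_abelian.
move=> _ /morphimP[x Nx Gx ->]; rewrite -morphX //; apply: coset_id.
apply/centerP; split; first exact: groupX.
by move=> y Gy; apply/commgP; rewrite (expg_comm_der1 _ cD Gx Gy) Dp // mem_der1.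
Qed.

Lemma comm_degree_central_prime p : prime p -> #|G^`(1)| = p ->
  (comm_degree G = p%:R^-1 + (1 - p%:R^-1) / #|G : 'Z(G)|%:R)%R.
Proof.
move=> pp oD; rewrite comm_degreeE (@eq_mean _ _ _ (fun x => p%:R^-1 +
  (1 - p%:R^-1) * mem_ind 'Z(G) x))%R; last first.
  move=> x Gx; rewrite /mem_ind; have [Zx|nZx] := boolP (x \in 'Z(G)).
    have /eqP-> : #|x ^: G| == 1%N by rewrite class1_center.
    rewrite invr1 /=; ring.
  by rewrite (class_prime pp) //= mulr0 addr0.
by rewrite meanD meanZ mean_const mean_ind // center_sub.
Qed.

Lemma structure_central_prime p : prime p -> #|G^`(1)| = p ->
  exists2 s, 0 < s & [/\ #|G : 'Z(G)| = (p ^ (2 * s))%N, G^`(1) \isog Cyc p,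
    G^`(1) :&: 'Z(G) \isog Cyc p & G / 'Z(G) \isog Elem p (2 * s)].
Proof.
move=> pp oD; have [s s0 es] := index_center_prime pp oD cD; exists s => //.
have iD := isog_Cyc_prime pp oD; rewrite (setIidPl cD); split=> //.
apply: isog_Elem => //; first by apply: quotient_center_abelem => // z; rewrite -oD; apply: expg_cardG.
by rewrite card_quotient ?normal_norm // center_normal.
Qed.

Lemma central_normal M : M \subset G^`(1) -> M <| G.
Proof. by move=> sMD; apply/sub_center_normal/(subset_trans sMD cD). Qed.

Lemma relZ_central_prime M p : prime p -> M \subset G^`(1) -> #|G^`(1) : M| = p ->
  (exists2 s, 0 < s & #|G : relZ G M| = (p ^ (2 * s))%N)
  /\ {in G, forall x, x \notin relZ G M -> p %| #|x ^: G|}.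
Proof.
move=> pp sMD iD; apply: relZ_prime => //; first exact: central_normal.
by have /commG1P-> : G^`(1) \subset 'C(G) := subset_trans cD (subsetIr _ _); rewrite sub1G.
Qed.

Lemma index_relZ_sq_le M p : prime p -> M \subset G^`(1) -> #|G^`(1) : M| = p ->
  p * p <= #|G : relZ G M|.
Proof.
move=> pp sMD iD; have [[s s0 ->] _] := relZ_central_prime pp sMD iD.
by rewrite mulnn; apply: leq_pexp2l; rewrite ?prime_gt0 // leq_pmulr.
Qed.

(** The class size is divisible by |G' : P| = 3 outside [relZ G P] and by |G' : M| = q outside
    [relZ G M], hence by 3q outside both. *)
Lemma central_3q_weight q P M x : prime q -> 3 < q -> #|G^`(1)| = (3 * q)%N ->
    P \subset G^`(1) -> #|P| = q -> M \subset G^`(1) -> #|M| = 3 -> x \in G ->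
  (#|x ^: G|%:R^-1 <= (3 * q)%:R^-1 +
    (q%:R^-1 * mem_ind (relZ G P) x + mem_ind (relZ G M) x))%R.
Proof.
move=> pq q3 oD sPD oP sMD oM Gx; have q0 := prime_gt0 pq.
have iP : #|G^`(1) : P| = 3 by rewrite -divgS // oD oP mulnK.
have iM : #|G^`(1) : M| = q by rewrite -divgS // oD oM mulKn.
have [_ WP] := relZ_central_prime (isT : prime 3) sPD iP.
have [_ WM] := relZ_central_prime pq sMD iM.
have c0 : 0 < #|x ^: G| by rewrite -index_cent1 indexg_gt0.
have q3' : ((0 : rat) <= (3 * q)%:R^-1)%R by rewrite invr_ge0 ler0n.
have q' : ((0 : rat) <= q%:R^-1)%R by rewrite invr_ge0 ler0n.
have le1 := ler_inv_nat (isT : 0 < 1) c0; rewrite invr1 in le1.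
have leq : x \notin relZ G M -> (#|x ^: G|%:R^-1 <= q%:R^-1 :> rat)%R.
  by move=> nMx; apply: ler_inv_nat (dvdn_leq c0 (WM x Gx nMx)).
have le3q : x \notin relZ G M -> x \notin relZ G P ->
    (#|x ^: G|%:R^-1 <= (3 * q)%:R^-1 :> rat)%R.
  move=> nMx nPx; apply: ler_inv_nat; rewrite ?muln_gt0 ?q0 // dvdn_leq //.
  by rewrite Gauss_dvd ?WP ?WM // prime_coprime // dvdn_prime2 // neq_ltn q3.
rewrite /mem_ind; move: q3' q' le1 leq le3q.
move: (_ \in _) (_ \in _) (_^-1)%R (_^-1)%R (_^-1)%R => [] [] a b c /=; clear => ? ? ? h1 h2.
- by lra.
- by move/(_ isT): h1; lra.
- by lra.
- by move/(_ isT isT): h2; lra.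
Qed.

Lemma central_3q_bound q P M : prime q -> 3 < q -> #|G^`(1)| = (3 * q)%N ->
    P \subset G^`(1) -> #|P| = q -> M \subset G^`(1) -> #|M| = 3 ->
  (comm_degree G <= (3 * q)%:R^-1 + (q%:R^-1 / 9%:R + q%:R^-1 / q%:R))%R.
Proof.
move=> pq q3 oD sPD oP sMD oM; have q0 := prime_gt0 pq.
have iP : #|G^`(1) : P| = 3 by rewrite -divgS // oD oP mulnK.
have iM : #|G^`(1) : M| = q by rewrite -divgS // oD oM mulKn.
have sWP := relZ_sub (central_normal sPD); have sWM := relZ_sub (central_normal sMD).
rewrite comm_degreeE; apply: le_trans (mean_le (fun x => @central_3q_weight q P M x _ _ _ _ _ _ _)) _ => //.
have -> : (q%:R^-1 / q%:R = (q * q)%:R^-1 :> rat)%R by rewrite natrM invfM.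
rewrite !meanD meanZ mean_const !mean_ind // lerD2l.
apply: lerD; last by apply: ler_inv_nat (index_relZ_sq_le pq sMD iM); rewrite muln_gt0 q0.
rewrite ler_pM2l ?invr_gt0 ?ltr0n //; exact: (ler_inv_nat (isT : 0 < 9) (index_relZ_sq_le (isT : prime 3) sPD iP)).
Qed.

End CentralCases.

(** * Central derived subgroup of order 9 *)

Lemma mean_sum (gT : finGroupType) (G : {group gT}) (I : finType) (E : {set I})
    (F : I -> gT -> rat) :
  (mean G (fun x => \sum_(i in E) F i x) = \sum_(i in E) mean G (F i))%R.
Proof. by rewrite /mean exchange_big mulr_suml. Qed.

Lemma central9_cyclic_weight (w z : bool) (a : rat) : (~~ w -> a = 9%:R^-1)%R ->
    (a <= 1)%R -> (~~ z -> a <= 3%:R^-1)%R ->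
  (a <= 9%:R^-1 + ((2%:R / 9%:R) * (w : nat)%:R + (2%:R / 3%:R) * (z : nat)%:R))%R.
Proof.
case: w z => [] [] /= h1 h2 h3; [lra | | lra | ].
- by move/(_ isT): h3; lra.
- by move/(_ isT): h1; lra.
Qed.

(** At the extreme values a = 1/81 and b = 1/9 the left side is 35/243. *)
Lemma central9_cyclic_arith (a b : rat) : (a <= 81%:R^-1)%R -> (b <= 9%:R^-1)%R ->
  (9%:R^-1 + ((2%:R / 9%:R) * b + (2%:R / 3%:R) * a) < 11%:R / 75%:R)%R.
Proof. lra. Qed.

Lemma inv9_le : (9%:R^-1 <= 81%:R^-1 + 8%:R / 81%:R * (true : nat)%:R :> rat)%R.
Proof. rewrite mulr1; lra. Qed.

(** Here b is the sum of 1 / |G : relZ G M| over the four lines M of G', and a is the number of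
    lines of index 9. If a is at most 1, the degree is at most 35/243. *)
Lemma central9_elem_arith (a b : rat) : (a <= 1)%R ->
  (b <= 81%:R^-1 *+ 4 + 8%:R / 81%:R * a)%R -> 
  (11%:R / 75%:R <= 9%:R^-1 + 2%:R / 9%:R * b)%R -> False.
Proof. lra. Qed.

Lemma index_leq_eq (gT : finGroupType) (G B A : {group gT}) :
  B \subset G -> A \subset B -> #|G : A| <= #|G : B| -> A :=: B.
Proof.
move=> sBG sAB; rewrite -(Lagrange_index sBG sAB) -{2}[#|G : B|]muln1 leq_pmul2l //.
by rewrite -[_ <= 1]orbF leqNgt indexg_gt1 orbF negbK => sBA; apply/eqP; rewrite eqEsubset sAB.
Qed.

Section CentralNine.
Variables (gT : finGroupType) (G : {group gT}).
Implicit Types M P N : {group gT}.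
Hypotheses (cD : G^`(1) \subset 'Z(G)) (oD : #|G^`(1)| = 9).

Let index3 M : M \subset G^`(1) -> #|M| = 3 -> #|G^`(1) : M| = 3.
Proof. by move=> sMD oM; rewrite -divgS // oD oM. Qed.

Lemma class_central9 x : x \in G -> x \notin 'Z(G) -> #|x ^: G| != 9 ->
  #|x ^: G| = 3 /\ exists M : {group gT}, M = commset G x :> {set gT}.
Proof.
move=> Gx nZx n9; split; last by exists (group (commset_group cD Gx)).
have := dvd_class_der1 cD Gx; rewrite oD.
have := class1_center Gx; rewrite (negbTE nZx).
move: #|_| n9 => n n9 n1 dn; have := dvdn_leq (isT : 0 < 9) dn.
by move: n n9 n1 dn => [|[|[|[|[|[|[|[|[|[]]]]]]]]]].
Qed.

Lemma sub_commset_relZ M x : M \subset G^`(1) -> x \in G ->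
  (commset G x \subset M) = (x \in relZ G M).
Proof.
move=> sMD Gx; apply/idP/(relZP _ (central_normal cD sMD)) => [/subsetP sSM|[_ cx]].
  by split=> // g Gg; apply/sSM/imset_f.
by apply/subsetP=> _ /imsetP[g Gg ->]; apply: cx.
Qed.

(** A cyclic G' has only one subgroup M of order 3, so a class of size 3 forces [x, G] = M; all
    classes outside [relZ G M] have size 9. *)
Lemma central9_cyclic_bound : cyclic G^`(1) -> (comm_degree G < 11%:R / 75%:R)%R.
Proof.
move=> cycD; have /cyclicP[c Dc] := cycD.
have oc : #[c] = 9 by rewrite orderE -Dc.
have o3 : #|<[c ^+ 3]>| = 3 by rewrite -orderE orderXdiv oc.
pose M := <[c ^+ 3]>%G.
have sMD : M \subset G^`(1) by rewrite Dc cycleX.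
have nMG := central_normal cD sMD.
have [[s s0 es] W3] := relZ_central_prime cD (isT : prime 3) sMD (index3 sMD o3).
have cl9 x : x \in G -> x \notin relZ G M -> #|x ^: G| = 9 /\ commset G x = G^`(1).
  move=> Gx nWx; have nZx : x \notin 'Z(G).
    by apply: contra nWx => /centerP[_ cx]; apply/relZP => //; split=> // g /cx/commgP/eqP->.
  have e9 : #|x ^: G| = 9.
    apply/eqP; apply: contraR nWx => /(class_central9 Gx nZx)[cl3 [S eS]].
    rewrite -sub_commset_relZ // -eS.
    have sSD : S \subset G^`(1) by rewrite eS commset_sub.
    suff /eqP-> : S :==: M by [].
    by rewrite (eq_subG_cyclic cycD) // o3 eS card_commset cl3.
  by split=> //; apply/eqP; rewrite eqEcard commset_sub //= oD card_commset e9.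
have i9 : 9 <= #|G : relZ G M| by rewrite es (@leq_pexp2l 3 2) // leq_pmulr.
(* For x outside [relZ G M], C_G(x) has index 9, and it contains x, whose image in G / Z(G) will be
   shown to have order 9. *)
have i81 : 81 <= #|G : 'Z(G)|.
  have [x Gx nWx] : exists2 x, x \in G & x \notin relZ G M.
    by apply/subsetPn; rewrite -indexg_gt1 (leq_trans _ i9).
  have [c9 eS] := cl9 x Gx nWx.
  have /imsetP[y Gy ey] : c \in commset G x by rewrite eS Dc cycle_id.
  have sZC : 'Z(G) \subset 'C_G[x] by exact: center_sub_cent1.
  have nZ := normal_norm (center_normal G).
  rewrite -(Lagrange_index (subsetIl G _) sZC) index_cent1 c9 (@leq_pmul2l 9 9) //.
  rewrite -card_quotient ?subIset ?nZ //; apply: dvdn_leq; first exact: cardG_gt0.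
  (* Since [x, G] = G', the generator c is some [x, y]. Hence x^n is central exactly when c^n =
     1. *)
  have xn n : (coset 'Z(G) x ^+ n == 1) = (9 %| n).
    rewrite -morphX ?(subsetP nZ) //= -oc order_dvdn ey -(expg_comm_der1 n cD Gx Gy).
    apply/eqP/eqP => [e1|e1].
      have /centerP[_ cxn] : x ^+ n \in 'Z(G).
        by apply: coset_idr; rewrite // (subsetP nZ) ?groupX.
      by apply/eqP/commgP/cxn.
    apply: coset_id; apply/centerP; split; first exact: groupX.
    move=> z Gz; apply/commgP; rewrite (expg_comm_der1 n cD Gx Gz).
    have : [~ x, z] \in <[c]> by rewrite -Dc mem_der1.
    case/cycleP=> k ->; rewrite -expgM mulnC expgM ey.
    by rewrite -(expg_comm_der1 n cD Gx Gy) e1 expg1n.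
  have -> : 9 = #[coset 'Z(G) x].
    by apply/eqP; rewrite eqn_dvd order_dvdn xn dvdnn -xn expg_order eqxx.
  by rewrite order_dvdG // mem_quotient // subcent1_id.
rewrite comm_degreeE; apply: le_lt_trans (_ : mean G (fun x => 9%:R^-1 +
  ((2%:R / 9%:R) * mem_ind (relZ G M) x + (2%:R / 3%:R) * mem_ind 'Z(G) x)) < _)%R.
  apply: mean_le => x Gx; apply: central9_cyclic_weight => [nWx||nZx].
  - by rewrite (cl9 x Gx nWx).1.
  - by rewrite -[1%R]invr1 (ler_inv_nat (isT : 0 < 1)) // -index_cent1 indexg_gt0.
  apply: (ler_inv_nat (isT : 0 < 3)); have [->//|n9] := eqVneq #|x ^: G| 9.
  by rewrite (class_central9 Gx nZx n9).1.
rewrite mean_ind2; [ | exact: relZ_sub | exact: center_sub].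
by apply: central9_cyclic_arith; apply: ler_inv_nat.
Qed.

(** * Central elementary abelian derived subgroup of order 9 *)

Hypothesis aD : 3.-abelem G^`(1).
Let E := 'E_3^1(G^`(1)).

Lemma central9_linesP M : reflect (M \subset G^`(1) /\ #|M| = 3) (M \in E).
Proof. by rewrite /E p1ElemE // !inE; apply: (iffP andP) => -[-> /eqP]. Qed.

Lemma central9_card_lines : #|E| = 4.
Proof.
have : G^`(1)%G \in 'E_3^2(G^`(1)) by apply/pnElemP; rewrite oD; split.
exact: card_p1Elem_p2Elem.
Qed.

(** A class of size 9 has [x, G] = G', contained in no line; a class of size 3 has [x, G] equal to
    exactly one line; a central x counts for all four lines, and 1/9 + 4 (2/9) = 1. *)
Lemma central9_comm_degree :
  (comm_degree G = 9%:R^-1 + 2%:R / 9%:R * \sum_(M in E) #|G : relZ G M|%:R^-1)%R.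
Proof.
rewrite comm_degreeE (@eq_mean _ _ _ (fun x => 9%:R^-1 +
  2%:R / 9%:R * \sum_(M in E) mem_ind (relZ G M) x))%R; last first.
  move=> x Gx; have [Zx|nZx] := boolP (x \in 'Z(G)).
    have /eqP-> : #|x ^: G| == 1%N by rewrite class1_center.
    rewrite (eq_bigr (fun=> 1%R)) => [|M /central9_linesP[sMD _]].
      by rewrite sumr_const central9_card_lines; field.
    rewrite /mem_ind; suff -> : x \in relZ G M by [].
    have /centerP[_ cx] := Zx.
    by apply/relZP; [exact: central_normal | split=> // g /cx/commgP/eqP->].
  have [e9|n9] := eqVneq #|x ^: G| 9.
    rewrite big1 ?mulr0 ?addr0 ?e9 // => M /central9_linesP[sMD oM].
    rewrite /mem_ind -sub_commset_relZ //; case: (boolP (_ \subset _)) => // /subset_leq_card.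
    by rewrite card_commset e9 oM.
  have [cl3 [S eS]] := class_central9 Gx nZx n9.
  have oS : #|S| = 3 by rewrite eS card_commset.
  have sSD : S \subset G^`(1) by rewrite eS commset_sub.
  have ES : S \in E by apply/central9_linesP.
  rewrite (bigD1 S) //= big1 => [|M /andP[/central9_linesP[sMD oM] neqMS]].
    by rewrite /mem_ind -sub_commset_relZ // -eS subxx cl3 addr0 mulr1; field.
  rewrite /mem_ind -sub_commset_relZ // -eS; case: (boolP (_ \subset _)) => // sSM.
  by case/eqP: neqMS; apply/val_inj/esym/eqP; rewrite eqEcard sSM oM oS.
rewrite meanD meanZ mean_const mean_sum; congr (_ + _ * _)%R; apply: eq_bigr => M.
by case/central9_linesP=> sMD _; rewrite mean_ind // relZ_sub // central_normal.
Qed.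

Lemma central9_index M : M \in E -> exists2 s, 0 < s & #|G : relZ G M| = (9 ^ s)%N.
Proof.
case/central9_linesP=> sMD oM.
have [[s s0 es] _] := relZ_central_prime cD (isT : prime 3) sMD (index3 sMD oM).
by exists s; rewrite // es expnM.
Qed.

(** Each index is a power of 9, so a line whose index is not 9 has index at least 81;
    [central9_elem_arith] then excludes at most one line of index 9. *)
Lemma central9_two_index9_lines : (11%:R / 75%:R <= comm_degree G)%R ->
  exists M1 M2, [/\ M1 \in E, M2 \in E, M1 != M2,
    #|G : relZ G M1| = 9 & #|G : relZ G M2| = 9].
Proof.
rewrite central9_comm_degree; pose E9 := [set M in E | #|G : relZ G M| == 9].
have [/card_gt1P[M1 [M2 []]]|le1] := ltnP 1 #|E9|.
  by move=> /setIdP[EM1 /eqP i1] /setIdP[EM2 /eqP i2] neq _; exists M1, M2; split.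
have : (\sum_(M in E) #|G : relZ G M|%:R^-1 <=
   \sum_(M in E) (81%:R^-1 + (8%:R / 81%:R) * (M \in E9 : nat)%:R) :> rat)%R.
  apply: ler_sum => M EM; have -> : (M \in E9) = (#|G : relZ G M| == 9) by rewrite in_set EM.
  have [->|n9] := eqVneq #|G : relZ G M| 9; first exact: inv9_le.
  have [s s0 es] := central9_index EM; rewrite es in n9 *.
  rewrite mulr0 addr0; apply: ler_inv_nat => //.
  by rewrite (@leq_pexp2l 9 2) //; case: s s0 n9 {es} => [|[]].
rewrite big_split /= sumr_const central9_card_lines -mulr_sumr -natr_sum.
have -> : (\sum_(M in E) (M \in E9) = #|E9|)%N.
  rewrite -sum1_card [RHS]big_mkcond [LHS]big_mkcond; apply: eq_bigr => M _ /=.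
  by case E9M: (M \in E9); [case/setIdP: E9M => -> | case: ifP].
move=> le_sum h; case: (central9_elem_arith _ le_sum h).
rewrite lern1; exact: le1.
Qed.

(** Two centres modulo lines, each of index 9, meet in Z(G), so G / Z(G) is elementary abelian of
    order 3^k with k from 2 to 4, and k determines every index in the degree formula. *)
Lemma central9_elem : (11%:R / 75%:R <= comm_degree G)%R ->
  (comm_degree G = 17%:R / 81%:R)%R /\ G / 'Z(G) \isog Elem 3 3
  \/ (comm_degree G = 121%:R / 729%:R)%R /\ G / 'Z(G) \isog Elem 3 4.
Proof.
move=> /central9_two_index9_lines[M1 [M2 [EM1 EM2 neq i1 i2]]].
have [sM1 o1] := central9_linesP _ EM1; have [sM2 o2] := central9_linesP _ EM2.
have nZ := normal_norm (center_normal G).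
have aQ : 3.-abelem (G / 'Z(G)).
  by apply: quotient_center_abelem => // z Dz; have /abelemP[] := aD => // _; apply.
have [k ek] := p_natP (abelem_pgroup aQ); rewrite card_quotient // in ek.
have TI M M' : M \in E -> M' \in E -> M != M' -> M :&: M' = 1.
  move=> /central9_linesP[_ oM] /central9_linesP[_ oM'] neqMM'; apply: prime_TIg; rewrite ?oM //.
  by apply: contra neqMM' => sMM'; apply/eqP/val_inj/eqP; rewrite eqEcard sMM' oM oM'.
have sZW M : M \in E -> 'Z(G) \subset relZ G M.
  case/central9_linesP=> sMD _; apply/subsetP=> x /centerP[Gx cx].
  by apply/relZP; [exact: central_normal | split=> // g /cx/commgP/eqP->].
have WP M x : M \in E -> x \in relZ G M -> x \in G /\ {in G, forall g, [~ x, g] \in M}.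
  by case/central9_linesP=> sMD _ /relZP; apply; apply: central_normal.
have sWG M : M \in E -> relZ G M \subset G.
  by case/central9_linesP=> sMD _; apply/relZ_sub/central_normal.
have eZ : relZ G M1 :&: relZ G M2 = 'Z(G).
  apply/eqP; rewrite eqEsubset subsetI (sZW _ EM1) (sZW _ EM2) !andbT; apply/subsetP=> x /setIP[W1x W2x].
  have [Gx c1] := WP _ _ EM1 W1x; have [_ c2] := WP _ _ EM2 W2x.
  apply/centerP; split=> // g Gg; apply/commgP; rewrite -in_set1 -[[set 1]]/(1 : {set gT}).
  by rewrite -(TI _ _ EM1 EM2 neq) inE c1 ?c2.
have le81 : #|G : 'Z(G)| <= 81.
  rewrite -eZ -(Lagrange_index (sWG _ EM1) (subsetIl _ _)) i1 (@leq_pmul2l 9 _ 9) // indexgI -i2.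
  exact/subset_leq_card/imsetS/sWG.
have k4 : k <= 4 by rewrite -(@leq_exp2l 3) // -ek.
have k2 : 1 < k.
  have := indexSg (sZW _ EM1) (sWG _ EM1); have := Lagrange_index (sWG _ EM1) (sZW _ EM1).
  rewrite i1 ek => e _; rewrite -(@leq_exp2l 3) // -e leq_pmulr // indexg_gt0.
have idx M : M \in E -> #|G : relZ G M| %| 3 ^ k.
  by move=> EM; rewrite -ek -(Lagrange_index (sWG _ EM) (sZW _ EM)) dvdn_mulr.
have isoQ : G / 'Z(G) \isog Elem 3 k by apply: isog_Elem; rewrite // card_quotient.
rewrite central9_comm_degree.
have [k3|k3|k3] := ltngtP k 3.
(* For k = 2, a class of size 3 would put x in a centre modulo a line, of index at least 9 and so
   equal to Z(G); a class of size 9 would make C_G(x) equal to Z(G). Both contradict the choice of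
   x. *)
- have {k2 k3 k4}k2: k = 2 by apply/eqP; rewrite eqn_leq k2 -ltnS k3.
  have [x Gx nZx] : exists2 x, x \in G & x \notin 'Z(G).
    by apply/subsetPn; rewrite -indexg_gt1 ek k2.
  have cl9 : #|x ^: G| = 9.
    apply/eqP; apply: (contraR _ nZx) => n9; have [cl3 [S eS]] := class_central9 Gx nZx n9.
    have sSD : S \subset G^`(1) by rewrite eS commset_sub.
    have ES : S \in E by apply/central9_linesP; split=> //; rewrite eS card_commset.
    rewrite (@index_leq_eq _ G (relZ G S) 'Z(G)%G) ?sWG ?sZW //=.
      by rewrite -sub_commset_relZ // -eS.
    by have [[//|s] _ ->] := central9_index ES; rewrite ek k2 (@leq_exp2l 9 1).
  case/negP: nZx; suff /= -> : 'Z(G)%G = 'C_G[x]%G :> {set gT} by apply: subcent1_id.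
  apply: index_leq_eq (subsetIl _ _) _ _; first exact: center_sub_cent1.
  by rewrite index_cent1 cl9 ek k2.
(* For k = 4, the two subgroups of index 9 multiply to G. Elements of centres modulo different lines
   commute, as their commutator lies in both lines; so for either remaining line the centre modulo
   it is Z(G). *)
- have {k2 k3 k4}k4: k = 4 by apply/eqP; rewrite eqn_leq k4 k3.
  right; split; last by rewrite -k4.
  suff -> : (\sum_(M in E) #|G : relZ G M|%:R^-1 = 9%:R^-1 + (9%:R^-1 + 81%:R^-1 *+ 2) :> rat)%R.
    by field.
  have EM2' : M2 \in E :\ M1 by rewrite in_setD1 eq_sym neq.
  rewrite (big_setD1 M1 EM1) (big_setD1 M2 EM2') i1 i2; congr (_ + (_ + _))%R.
  have c2 : #|E :\ M1 :\ M2| = 2.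
    by have := central9_card_lines; rewrite (cardsD1 M1) EM1 (cardsD1 M2) EM2' => -[].
  rewrite (eq_bigr (fun=> 81%:R^-1)%R) ?sumr_const ?c2 // => M /setD1P[n2 /setD1P[n1 EM]].
  suff -> : relZ G M = 'Z(G) :> {set gT} by rewrite ek k4.
  apply/eqP; rewrite eqEsubset sZW // andbT; apply/subsetP=> x Wx.
  have [Gx cx] := WP _ _ EM Wx; apply/centerP; split=> // g.
  have cW M' y : M' \in E -> M != M' -> y \in relZ G M' -> [~ x, y] = 1.
    move=> EM' neq' Wy; have [Gy cy] := WP _ _ EM' Wy.
    apply/set1P; rewrite -[[set 1]]/(1 : {set gT}) -(TI _ _ EM EM' neq') inE cx //.
    by rewrite -groupV invg_comm cy.
  have <- : relZ G M1 * relZ G M2 = G.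
    apply/eqP; rewrite eqEcard mul_subG ?sWG //= -(leq_pmul2r (cardG_gt0 'Z(G))).
    have := Lagrange_index (sWG _ EM1) (sZW _ EM1); rewrite i1 ek k4 => /eqP.
    rewrite (@eqn_pmul2l 9 _ 9) // => /eqP iW1.
    rewrite -[X in _ <= _ * X](congr1 (fun B : {set gT} => #|B|) eZ) -mul_cardG.
    rewrite -(Lagrange (sWG _ EM2)) -(Lagrange (sZW _ EM1)) i2 iW1.
    by rewrite mulnC [(_ * 9)%N]mulnC mulnA leqnn.
  case/mulsgP=> y z Wy Wz ->; apply/commgP; rewrite commgMJ.
  by rewrite (cW _ _ EM1 n1 Wy) (cW _ _ EM2 n2 Wz) conj1g mulg1.
(* For k = 3, every index is a positive power of 9 dividing 27, hence 9. *)
- left; split; last by rewrite k3 in isoQ.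
  rewrite (eq_bigr (fun=> 9%:R^-1)%R) => [|M EM].
    by rewrite sumr_const central9_card_lines; field.
  have [s s0 es] := central9_index EM.
  have := idx M EM; rewrite es k3; case: s s0 {es} => [|[|s]] // _.
  by move/dvdn_leq => /(_ isT); rewrite leqNgt (@leq_trans (9 ^ 2)%N) // leq_exp2l.
Qed.

End CentralNine.

(** * Non-central derived subgroups *)

Lemma leq_index_TI (gT : finGroupType) (D H P : {group gT}) :
  H \subset D -> P \subset D -> P :&: H = 1 -> #|P| <= #|D : H|.
Proof.
move=> sHD sPD ti; rewrite -(leq_pmul2r (cardG_gt0 H)) -(TI_cardMg ti).
by rewrite [(#|D : H| * _)%N]mulnC Lagrange // subset_leq_card // mul_subG.
Qed.

Lemma abelem_or_cyclic_p2 (gT : finGroupType) (N : {group gT}) p :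
  prime p -> #|N| = (p ^ 2)%N -> ~~ cyclic N -> p.-abelem N.
Proof.
move=> pp oN nc; apply/abelemP => //; split; first exact: card_p2group_abelian oN.
move=> x Nx; apply/eqP; rewrite -order_dvdn.
have /(dvdn_pfactor _ _ pp)[[|[|[|//]]] _ e] : #[x] %| p ^ 2 by rewrite -oN order_dvdG.
- by rewrite e expn0 dvd1n.
- by rewrite e expn1.
case/negP: nc; apply/cyclicP; exists x; apply/esym/eqP.
by rewrite eqEcard cycle_subG Nx oN -e leqnn.
Qed.

Lemma cyclic_p2_normal (gT : finGroupType) (G N : {group gT}) p :
  prime p -> #|N| = (p ^ 2)%N -> cyclic N -> N <| G ->
  exists M : {group gT}, [/\ M <| G, M \subset N & #|M| = p].
Proof.
move=> pp oN cN nNG; have [c Dc] := cyclicP cN.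
have oc : #[c] = (p ^ 2)%N by rewrite orderE -Dc.
exists <[c ^+ p]>%G; split; last by rewrite -orderE orderXdiv oc ?mulnK ?prime_gt0 // dvdn_mulr.
  apply: char_normal_trans nNG; rewrite {1}Dc; exact: cycle_subgroup_char (cycleX _ _).
by rewrite Dc cycleX.
Qed.

(** * Conjugation on the lines of a normal elementary abelian subgroup of order p^2 *)

Section Lines.
Variables (gT : finGroupType) (G N : {group gT}) (p : nat).
Implicit Types L M : {group gT}.
Hypotheses (oddG : odd #|G|) (nNG : N <| G) (pp : prime p) (oN : #|N| = (p ^ 2)%N).
Hypothesis aN : p.-abelem N.

Let linesP L : reflect (L \subset N /\ #|L| = p) (L \in 'E_p^1(N)).
Proof. by rewrite p1ElemE // !inE; apply: (iffP andP) => -[-> /eqP]. Qed.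

(** There are p + 1 lines, so an orbit of length p leaves a single line, which is then normal. As
    orbit lengths are odd, the second alternative is impossible for p = 3 and means length 3 for p =
    5. *)
Lemma lines_orbit L : L \subset N -> #|L| = p -> ~~ (G \subset 'N(L)) ->
  (exists M : {group gT}, [/\ M <| G, M \subset N & #|M| = p])
  \/ #|orbit 'JG G L| <> p /\ #|orbit 'JG G L| <= p.+1 /\ 1 < #|orbit 'JG G L|.
Proof.
move=> sLN oL nL; pose O := orbit 'JG G L.
have cE : #|'E_p^1(N)| = p.+1.
  have : N \in 'E_p^2(N) by apply/pnElemP; rewrite oN pfactorK //; split.
  exact: card_p1Elem_p2Elem.
have actE M g : g \in G -> M \in 'E_p^1(N) -> ('JG%act M g) \in 'E_p^1(N).
  move=> Gg /linesP[sMN oM]; apply/linesP; rewrite /= cardJg; split=> //.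
  by rewrite -(normsP (normal_norm nNG) g Gg) conjSg.
have sOE : O \subset 'E_p^1(N).
  by apply/subsetP=> _ /imsetP[g Gg ->]; apply: actE => //; apply/linesP.
have leO := subset_leq_card sOE; rewrite cE in leO.
have [eO|nO] := eqVneq #|O| p; last first.
  right; split; [exact/eqP | split=> //].
  by rewrite card_orbit astab1JG indexg_gt1 subsetI subxx.
left; have : #|'E_p^1(N) :\: O| = 1%N by rewrite cardsD (setIidPr sOE) cE eO subSnn.
move/eqP/cards1P=> [M eM]; have : M \in 'E_p^1(N) :\: O by rewrite eM set11.
case/setDP=> EM nOM; have [sMN oM] := linesP _ EM; exists M; split=> //.
rewrite /normal (subset_trans sMN (normal_sub nNG)) /=.
apply/normsP=> g Gg.
have : ('JG%act M g) \in 'E_p^1(N) :\: O.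
  rewrite inE actE // andbT; apply: contra nOM => /imsetP[h Gh /(congr1 val)/= e].
  apply/imsetP; exists (h * g^-1); first by rewrite groupM ?groupV.
  by apply: val_inj; rewrite /= conjsgM -e conjsgK.
by rewrite eM => /set1P /(congr1 val).
Qed.

End Lines.

(** * The centraliser of a non-central derived subgroup *)

Section Noncentral.
Variables (gT : finGroupType) (G : {group gT}).
Implicit Types M P N : {group gT}.
Hypotheses (oddG : odd #|G|) (ncD : ~~ (G^`(1) \subset 'Z(G))).

Definition Cder : {group gT} := 'C_G(G^`(1))%G.

Lemma Cder_normal : Cder <| G.
Proof.
by have := subcent_normal G G^`(1); rewrite (setIidPl (normal_norm (der_normal 1 G))).
Qed.

Lemma Cder_sub : Cder \subset G. Proof. exact: subsetIl. Qed.

Lemma nonabelian_noncentral : ~~ abelian G.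
Proof. by apply: contra ncD => /derG1P ->; apply: sub1G. Qed.

Lemma Cder_index_gt2 : 2 < #|G : Cder|.
Proof.
have := dvdn_odd (dvdn_indexg G Cder) oddG; have : 1 < #|G : Cder|.
  rewrite indexg_gt1; apply: contra ncD; rewrite subsetI subxx /= centsC => cD.
  by rewrite subsetI der_sub.
by move: #|_ : _| => [|[|[|]]].
Qed.

Lemma Cder_abelian_TI : G^`(1) :&: 'Z(G) = 1 -> abelian Cder.
Proof.
move=> ti; apply/derG1P/trivgP; rewrite -ti subsetI der1_cent_der1 andbT.
exact: dergS Cder_sub.
Qed.

Lemma center_Cder : 'Z(G) \subset Cder.
Proof. by rewrite setIS // centS // der_sub. Qed.

Lemma der1_TI_center_prime : prime #|G^`(1)| -> G^`(1) :&: 'Z(G) = 1.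
Proof. by move=> pD; apply: prime_TIg. Qed.

Lemma quotient_center_nonabelian : ~~ abelian (G / 'Z(G)).
Proof.
apply: contra ncD => aQ; apply: der1_min => //; exact: normal_norm (center_normal G).
Qed.

Lemma sdprod_Cder (aT : finGroupType) (A : {set aT}) : abelian Cder -> #|G : Cder| = 3 ->
  Cder / 'Z(G) \isog A -> is_nonab_sdprod (G / 'Z(G)) A (Cyc 3).
Proof.
move=> aC iC isoA; have pC : prime #|G : Cder| by rewrite iC.
have [x Gx nCx] := exists_out_prime_index pC.
have [e ox] := quotient_center_sdprod Cder_normal aC pC nonabelian_noncentral Gx nCx.
exists (Cder / 'Z(G))%G, <[coset 'Z(G) x]>%G; split=> //; last exact: quotient_center_nonabelian.
by apply: isog_Cyc_prime => //; rewrite -orderE ox iC.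
Qed.

Lemma card_Cder_quotient : abelian Cder -> prime #|G : Cder| ->
  #|Cder / 'Z(G)| = #|G^`(1)|.
Proof.
move=> aC pC; rewrite card_quotient.
  exact: index_center_abelian_prime_index Cder_normal aC pC nonabelian_noncentral.
exact: subset_trans Cder_sub (normal_norm (center_normal G)).
Qed.

(** These are the groups attaining the character bound [comm_degree_der1]. *)
Lemma comm_degree_Cder : abelian Cder -> #|G : Cder| = 3 ->
  (comm_degree G = 9%:R^-1 + 8%:R / 9%:R / #|(G^`(1))%g|%:R)%R.
Proof.
move=> aC iC; have pC : prime #|G : Cder| by rewrite iC.
rewrite (comm_degree_abelian_prime_index Cder_normal aC pC nonabelian_noncentral) iC.
by field; rewrite pnatr_eq0 -lt0n cardG_gt0.
Qed.

End Noncentral.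

(** * Non-central derived subgroup: prime order and order 25 *)

(** Here p is |G'| and m the index of its centraliser. A finite check leaves six pairs; the three
    with m above 3 are later excluded by the size of the degree. *)
Lemma noncentral_prime_arith p m : prime p -> p <= 25 -> odd p -> m %| p.-1 -> odd m -> 2 < m ->
  (p, m) \in [:: (7, 3); (13, 3); (19, 3); (11, 5); (19, 9); (23, 11)].
Proof.
move=> pp le25 op dm om m2.
have chk : all (fun p => all (fun m => [&& prime p, odd p, m %| p.-1, odd m & 2 < m] ==>
  ((p, m) \in [:: (7, 3); (13, 3); (19, 3); (11, 5); (19, 9); (23, 11)])) (iota 0 26)) (iota 0 26).
  by vm_compute.
have p0 : 0 < p.-1 by case: p pp op {le25 dm} => [|[|[]]].
have lem : m < 26 by have := dvdn_leq p0 dm; lia.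
have /allP/(_ p) := chk; rewrite mem_iota => /(_ le25) /allP /(_ m); rewrite mem_iota => /(_ lem).
by rewrite pp op dm om m2.
Qed.

Lemma prime11_arith : (11%:R / 75%:R <=
  11%:R^-1 + (5%:R^-1 - 11%:R^-1) / 5%:R + (1 - 5%:R^-1) / (5%:R * 11%:R) :> rat)%R -> False.
Proof. lra. Qed.

Lemma prime19_weight (c z : bool) (a b : rat) : (a <= 1)%R -> (~~ z -> a <= 3%:R^-1)%R ->
    (~~ c -> a <= b)%R -> (0 <= b)%R -> (z -> c) ->
  (a <= b + (3%:R^-1 * (c : nat)%:R + 2%:R / 3%:R * (z : nat)%:R))%R.
Proof.
case: c z => [] [] /= h1 h2 h3 h4 h5; [lra | | by have := h5 isT | ].
- by move/(_ isT): h2; lra.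
- by move/(_ isT): h3; lra.
Qed.

Lemma prime19_arith (a b c : rat) : (a <= 19%:R^-1)%R -> (b <= 9%:R^-1)%R -> (c <= 171%:R^-1)%R ->
  (11%:R / 75%:R <= a + (3%:R^-1 * b + 2%:R / 3%:R * c))%R -> False.
Proof. lra. Qed.

Section NoncentralPrime.
Variables (gT : finGroupType) (G : {group gT}).
Implicit Types M P N : {group gT}.
Hypotheses (oddG : odd #|G|) (ncD : ~~ (G^`(1) \subset 'Z(G))).

Lemma noncentral_prime_bound : prime #|G^`(1)| -> 18 < #|G^`(1)| -> 8 < #|G : Cder G| ->
  (11%:R / 75%:R <= comm_degree G)%R -> False.
Proof.
move=> pD p18 m8; have ti := der1_TI_center_prime ncD pD.
have aC := Cder_abelian_TI ti.
have sDC : G^`(1) \subset Cder G.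
  by rewrite subsetI der_sub; apply/cyclic_abelian/prime_cyclic.
have iZ : 171 <= #|G : 'Z(G)|.
  rewrite -(Lagrange_index (Cder_sub G) (center_Cder G)) (@leq_mul 9 19) //.
  exact: leq_trans p18 (leq_index_TI (center_Cder G) sDC ti).
have p0 := cardG_gt0 G^`(1).
have le : (comm_degree G <= mean G (fun x => #|(G^`(1))%g|%:R^-1 +
    (3%:R^-1 * mem_ind (Cder G) x + 2%:R / 3%:R * mem_ind 'Z(G) x)))%R.
  rewrite comm_degreeE; apply: mean_le => x Gx.
  have c0 : 0 < #|x ^: G| by rewrite -index_cent1 indexg_gt0.
  apply: prime19_weight => [|nZx|nCx||].
  - by rewrite -[1%R]invr1 (ler_inv_nat (isT : 0 < 1)).
  - by apply: (ler_inv_nat (isT : 0 < 3)); apply: class_gt2.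
  (* Outside C, C_G(x) meets the prime-order G' trivially, so the class has at least |G'|
     elements. *)
  - apply: ler_inv_nat => //; rewrite -index_cent1; apply: leq_index_TI (subsetIl _ _) (der_sub 1 G) _.
    apply: prime_TIg => //; apply: contra nCx => sDC'; rewrite inE Gx -sub_cent1.
    exact: subset_trans sDC' (subsetIr _ _).
  - by rewrite invr_ge0 ler0n.
  - exact: subsetP (center_Cder G) x.
move/le_trans/(_ le); rewrite mean_ind2; [ | exact: Cder_sub | exact: center_sub].
move=> h; apply: (prime19_arith _ _ _ h); clear h le.
- exact: (ler_inv_nat (isT : 0 < 19)).
- exact: (ler_inv_nat (isT : 0 < 9)).
- exact: (ler_inv_nat (isT : 0 < 171)).
Qed.

Lemma noncentral_prime : prime #|G^`(1)| -> #|G^`(1)| <= 25 ->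
  (11%:R / 75%:R <= comm_degree G)%R ->
  [/\ #|G : Cder G| = 3, abelian (Cder G) & #|G^`(1)| \in [:: 7; 13; 19]].
Proof.
move=> pD le25; have aC := Cder_abelian_TI (der1_TI_center_prime ncD pD).
have := noncentral_prime_arith pD le25 (dvdn_odd (cardSg (der_sub 1 G)) oddG)
  (index_cent_prime pD (der_normal 1 G)) (dvdn_odd (dvdn_indexg G (Cder G)) oddG)
  (Cder_index_gt2 oddG ncD).
rewrite !inE !xpair_eqE.
case/or4P.
- by case/andP=> /eqP-> /eqP-> _.
- by case/andP=> /eqP-> /eqP-> _.
- by case/andP=> /eqP-> /eqP-> _.
case/or3P.
- case/andP=> /eqP e11 /eqP e5.
  have pC : prime #|G : Cder G| by rewrite e5.
  rewrite (comm_degree_abelian_prime_index (Cder_normal G) aC pC (nonabelian_noncentral ncD)).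
  rewrite e11 e5 => h; case: (prime11_arith h).
- case/andP=> /eqP e1 /eqP e2 h; case: (noncentral_prime_bound pD _ _ h); clear h; rewrite ?e1 ?e2 //.
- case/andP=> /eqP e1 /eqP e2 h; case: (noncentral_prime_bound pD _ _ h); clear h; rewrite ?e1 ?e2 //.
Qed.

End NoncentralPrime.

(** * Derived subgroup of order 25 with character degrees at most 3 *)

Section TwentyFive.
Variables (gT : finGroupType) (G : {group gT}).
Implicit Types M P N : {group gT}.
Hypotheses (oddG : odd #|G|) (oD : #|G^`(1)| = 25).
Hypothesis irr3 : forall i : Iirr G, irrdeg i <= 3.

(** G / M would have a derived subgroup of order 5, central by oddness, so its centre has index a
    power of 5. This forbids degree 3, all degrees of G / M are 1, and G / M would be abelian. *)
Lemma no_normal5 M : M <| G -> M \subset G^`(1) -> #|M| = 5 -> False.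
Proof.
move=> nMG sMD oM; have nM := normal_norm nMG.
have oDM : #|(G / M)^`(1)| = 5.
  rewrite -quotient_der // card_quotient ?(subset_trans (der_sub 1 G)) //.
  by rewrite -divgS // oD oM.
have oddQ : odd #|G / M| := dvdn_odd (dvdn_quotient G M) oddG.
have cDM : (G / M)^`(1) \subset 'Z(G / M).
  by apply: odd_normal_35_central => //; [exact: der_normal | rewrite oDM].
have [s _ es] := index_center_prime (isT : prime 5) oDM cDM.
have : abelian (G / M).
  apply/char_abelianP => j; rewrite lin_irrdeg.
  have : irrdeg j <= 3.
    have := irr3 (mod_Iirr j).
    suff -> : irrdeg (mod_Iirr j) = irrdeg j by [].
    apply/eqP; rewrite -(eqr_nat algC) -!irr1_degree mod_IirrE // cfMod1 //.
  have := odd_irrdeg j oddQ; have : irrdeg j != 3.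
    apply/negP => /eqP d3; have := dvd_irr1_index_center j.
    rewrite irr1_degree /= -/(irrdeg j) dvdC_nat d3 => d3i.
    have : 3 %| 5 ^ (2 * s).
      have sZ : 'Z(G / M) \subset 'Z(('chi_j)%R)%CF by rewrite -cap_cfcenter_irr; apply: bigcap_inf.
      by rewrite -es; apply: dvdn_trans d3i _; apply: indexgS sZ.
    by rewrite Euclid_dvdX.
  by case: (irrdeg j) => [|[|[|[|]]]].
by move/derG1P=> D1; rewrite D1 cards1 in oDM.
Qed.

Lemma der1_25_abelem : 5.-abelem G^`(1).
Proof.
apply: abelem_or_cyclic_p2 => //; apply/negP => cD.
have [M [nMG sMD oM]] := cyclic_p2_normal (isT : prime 5) oD cD (der_normal 1 G).
exact: no_normal5 oM.
Qed.

Lemma der1_25_TI : G^`(1) :&: 'Z(G) = 1.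
Proof.
apply/eqP; apply: contraT => nt.
have : 5 %| #|G^`(1) :&: 'Z(G)|.
  have := cardSg (subsetIl G^`(1) 'Z(G)); rewrite oD -[25]/(5 ^ 2)%N.
  case/(dvdn_pfactor _ _ (isT : prime 5)) => [[|k] _ e]; last by rewrite e expnS dvdn_mulr.
  by move/card1_trivg: e => e; rewrite e eqxx in nt.
case/(Cauchy (isT : prime 5)) => x /setIP[Dx Zx] ox.
exfalso; apply: (@no_normal5 <[x]>%G); rewrite ?cycle_subG //.
by apply: sub_center_normal; rewrite cycle_subG.
Qed.

(** The orbit of a line L has length 3, so its stabiliser S has index 3. By oddness S also fixes the
    other two lines of the orbit and acts trivially on each fixed line; two of the lines generate
    G', so S centralises G'. *)
Lemma Cder_25 : #|G : Cder G| = 3.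
Proof.
have nDG := der_normal 1 G; have aD := der1_25_abelem; have sDG := der_sub 1 G.
have cDD : abelian G^`(1) := abelem_abelian aD.
have : 5 %| #|G^`(1)| by rewrite oD.
case/(Cauchy (isT : prime 5)) => x Dx ox; have Gx := subsetP sDG x Dx.
pose L := <[x]>%G; have oL : #|L| = 5 by [].
have sLD : L \subset G^`(1) by rewrite cycle_subG.
have nL : ~~ (G \subset 'N(L)).
  by apply/negP => nL; apply: (no_normal5 _ sLD oL); rewrite /normal (subset_trans sLD).
have [[M [nMG sMD oM]]|[O5 [O6 O1]]] := lines_orbit nDG (isT : prime 5) oD aD sLD oL nL.
  by case: (no_normal5 nMG sMD oM).
have O3 : #|orbit 'JG G L| = 3.
  have : odd #|orbit 'JG G L| by apply: dvdn_odd oddG; apply: dvdn_orbit.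
  by move: #|_| O5 O6 O1 => [|[|[|[|[|[|[|]]]]]]].
have cent5 (H : {group gT}) (K : {group gT}) : H \subset G -> K \subset H -> #|K| = 5 ->
    H \subset 'N(K) -> H \subset 'C(K).
  move=> sHG sKH oK nK; rewrite centsC; apply: subset_trans (subsetIr H _).
  by apply: odd_normal_35_central; rewrite /normal ?sKH ?oK // (dvdn_odd (cardSg sHG)).
pose S := 'N_G(L)%G; have iS : #|G : S| = 3 by rewrite -O3 card_orbit astab1JG.
have sSG : S \subset G := subsetIl _ _.
have sDS : G^`(1) \subset S by rewrite subsetI sDG cents_norm // centsC (subset_trans sLD).
have SL : S \subset 'C(L).
  by apply: cent5; rewrite // ?subsetIr // (subset_trans sLD).
have c2 : #|orbit 'JG G L :\ L| = 2.
  by have := cardsD1 L (orbit 'JG G L); rewrite O3 orbit_refl => -[e]; apply: esym e.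
have [K OK neqKL] : exists2 K, K \in orbit 'JG G L & K != L.
  have : 0 < #|orbit 'JG G L :\ L| by rewrite c2.
  by case/card_gt0P=> K /setD1P[neq OK]; exists K.
have [g Gg eK] := imsetP OK.
have oK : #|K| = 5 by rewrite eK /= cardJg.
have sKD : K \subset G^`(1) by rewrite eK /= -(normsP (normal_norm nDG) g Gg) conjSg.
have SK : S \subset 'C(K).
  apply: cent5; rewrite // ?(subset_trans sKD) //.
  (* S permutes the two lines of the orbit other than L, in orbits of odd length. *)
  have O'1 : #|orbit 'JG S K| = 1%N.
    have : odd #|orbit 'JG S K| by apply: dvdn_odd (dvdn_orbit _ _ _) (dvdn_odd (cardSg sSG) oddG).
    have : #|orbit 'JG S K| <= 2.
      rewrite -c2; apply: subset_leq_card.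
      apply/subsetP=> _ /imsetP[h Sh ->]; have Gh := subsetP sSG h Sh.
      rewrite in_setD1; apply/andP; split.
        apply: contra neqKL => /eqP /(congr1 val) /= e; apply/eqP/val_inj => /=.
        by rewrite -[LHS](conjsgK h) e (normsP (subsetIr G 'N(L))) // groupV.
      apply/imsetP; exists (g * h); first exact: groupM.
      by apply: val_inj; rewrite eK /= conjsgM.
    by move: #|_| => [|[|[|]]].
  have := O'1; rewrite card_orbit astab1JG => /eqP; rewrite indexg_eq1 => /subset_trans; apply.
  exact: subsetIr.
suff -> : Cder G = S :> {set gT} by [].
apply/eqP; rewrite eqEsubset; apply/andP; split.
  by rewrite setIS // cents_norm // centS.
rewrite subsetI sSG centsC.
have <- : K * L = G^`(1).
  apply/eqP; rewrite eqEcard mul_subG //= TI_cardMg ?oK ?oL ?oD //.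
  apply: prime_TIg; rewrite ?oK //; apply: contra neqKL => sKL.
  by apply/eqP/val_inj/eqP; rewrite eqEcard sKL oK oL.
by rewrite mul_subG // centsC.
Qed.

End TwentyFive.

(** * Non-central derived subgroup of order 9 *)

(** If the class of x does not shrink modulo M, the projection is injective on it, so x^g congruent
    to x modulo M forces x^g = x. *)
Lemma class_quotient_inj (gT : finGroupType) (G M : {group gT}) x g :
    M <| G -> x \in G -> g \in G -> #|x ^: G| <= #|coset M x ^: (G / M)| ->
  [~ x, g] \in M -> [~ x, g] = 1.
Proof.
move=> nMG Gx Gg le Mxg; have nM := subsetP (normal_norm nMG).
have eim : [set coset M y | y in x ^: G] = coset M x ^: (G / M).
  apply/setP=> yb; apply/imsetP/imsetP => [[_ /imsetP[h Gh ->] ->]|[_ /morphimP[h Nh Gh ->] ->]].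
    by exists (coset M h); rewrite ?mem_quotient // morphJ ?nM.
  by exists (x ^ h); rewrite ?morphJ ?nM //; apply: imset_f.
have inj : {in x ^: G &, injective (coset M)}.
  by apply/imset_injP; rewrite eqn_leq leq_imset_card eim le.
rewrite commgEl; suff -> : x ^ g = x by rewrite mulVg.
apply: inj; rewrite ?class_refl ?memJ_class //.
by rewrite -[x ^ g](mulKVg x) -commgEl morphM ?nM ?groupR //= (coset_id Mxg) mulg1.
Qed.

(** C' is nontrivial and lies in G' :&: Z(G), so it is central of order 3 and the even-power theorem
    applies to C itself. *)
Lemma center_index_Cder (gT : finGroupType) (G : {group gT}) :
  ~~ abelian (Cder G) -> #|G^`(1) :&: 'Z(G)| = 3 -> 9 <= #|Cder G : 'Z(Cder G)|.
Proof.
move=> nC o3; have sC : (Cder G)^`(1) \subset 'Z(G) := der1_cent_der1 G.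
have sC3 : (Cder G)^`(1) \subset G^`(1) :&: 'Z(G) by rewrite subsetI dergS ?Cder_sub.
have oC : #|(Cder G)^`(1)| = 3.
  have := cardSg sC3; rewrite o3 => /(primeP (isT : prime 3)).2 /orP[|/eqP//].
  by rewrite -trivg_card1 => /eqP /derG1P aC; rewrite aC in nC.
have cC : (Cder G)^`(1) \subset 'Z(Cder G).
  rewrite subsetI der_sub (subset_trans sC) // (subset_trans (subsetIr _ _)) //.
  exact/centS/Cder_sub.
have [s s0 ->] := index_center_prime (isT : prime 3) oC cC.
by rewrite (@leq_pexp2l 3 2) // leq_pmulr.
Qed.

(** Inclusion-exclusion: w and c each raise 1/9 to 1/3 and their overlap is subtracted once. The
    grouping, with its 0, lets [mean_ind2] apply to each half. *)
Lemma nine_weight (w c z : bool) (a : rat) : (z -> w && c) -> (a <= 1)%R ->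
    (~~ z -> a <= 3%:R^-1)%R -> (~~ w -> ~~ c -> a <= 9%:R^-1)%R ->
  (a <= (9%:R^-1 + (2%:R / 9%:R * (w : nat)%:R + 2%:R / 9%:R * (c : nat)%:R))
    + (0 + (- (2%:R / 9%:R) * ((w && c) : nat)%:R + 2%:R / 3%:R * (z : nat)%:R)))%R.
Proof.
case: w c z => [] [] [] /= h1 h2 h3 h4; try (exfalso; discriminate (h1 isT)).
- lra.
- by move/(_ isT): h3; lra.
- by move/(_ isT): h3; lra.
- by move/(_ isT): h3; lra.
- by move/(_ isT isT): h4; lra.
Qed.

(** The condition 3 z <= y makes the last two terms sum to at most 0, and the rest is at most
    35/243. *)
Lemma nine_arith (w c y z : rat) : (w <= 9%:R^-1)%R -> (c <= 27%:R^-1)%R -> (3%:R * z <= y)%R ->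
  (11%:R / 75%:R <= (9%:R^-1 + (2%:R / 9%:R * w + 2%:R / 9%:R * c))
    + (0 + (- (2%:R / 9%:R) * y + 2%:R / 3%:R * z)))%R -> False.
Proof. lra. Qed.

Section NoncentralNine.
Variables (gT : finGroupType) (G : {group gT}).
Implicit Types L : {group gT}.
Hypotheses (oddG : odd #|G|) (ncD : ~~ (G^`(1) \subset 'Z(G))) (oD : #|G^`(1)| = 9).

(** A cyclic G' has a characteristic subgroup of order 3. In the elementary abelian case, if no line
    were normal, the orbit of a line would have even length 2 or 4. *)
Lemma der1_9_line : exists M : {group gT}, [/\ M <| G, M \subset G^`(1) & #|M| = 3].
Proof.
have nDG := der_normal 1 G; have sDG := der_sub 1 G.
have [cD|nc] := boolP (cyclic G^`(1)); first exact: cyclic_p2_normal (isT : prime 3) oD cD nDG.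
have aD := abelem_or_cyclic_p2 (isT : prime 3) oD nc.
have : 3 %| #|G^`(1)| by rewrite oD.
case/(Cauchy (isT : prime 3)) => x Dx ox.
pose L := <[x]>%G; have oL : #|L| = 3 by [].
have sLD : L \subset G^`(1) by rewrite cycle_subG.
have [nL|nL] := boolP (G \subset 'N(L)).
  by exists L; split=> //; rewrite /normal (subset_trans sLD).
have [//|[O3 [O4 O1]]] := lines_orbit nDG (isT : prime 3) oD aD sLD oL nL.
have : odd #|orbit 'JG G L| by apply: dvdn_odd oddG; apply: dvdn_orbit.
by move: #|_| O3 O4 O1 => [|[|[|[|[|]]]]].
Qed.

Variable M : {group gT}.
Hypotheses (nMG : M <| G) (sMD : M \subset G^`(1)) (oM : #|M| = 3).

Let sMZ : M \subset 'Z(G).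
Proof. by apply: odd_normal_35_central; rewrite ?oM. Qed.

Let iM : #|G^`(1) : M| = 3.
Proof. by rewrite -divgS // oD oM. Qed.

Lemma der1_9_center : G^`(1) :&: 'Z(G) = M.
Proof.
have sM : M \subset G^`(1) :&: 'Z(G) by rewrite subsetI sMD.
apply/esym/eqP; rewrite eqEcard sM oM /=.
have := cardSg (subsetIl G^`(1) 'Z(G)); rewrite oD => d9.
have ne9 : #|G^`(1) :&: 'Z(G)| != 9.
  apply: contra ncD => /eqP e9; apply/setIidPl/eqP.
  by rewrite eqEcard subsetIl e9 oD.
have := dvdn_leq (isT : 0 < 9) d9; move: #|_| d9 ne9 => [|[|[|[|[|[|[|[|[|[|]]]]]]]]]] //.
Qed.

Lemma der1_9_comm : [~: G^`(1), G] \subset M.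
Proof.
have nM := normal_norm nMG; have nMD := subset_trans (der_sub 1 G) nM.
rewrite -quotient_cents2 //; apply: subset_trans (subsetIr (G / M) _).
apply: odd_normal_35_central; first exact: dvdn_odd (dvdn_quotient G M) oddG.
  exact: quotient_normal (der_normal 1 G).
by rewrite card_quotient // iM.
Qed.

Lemma comm_der1_9 n g : n \in G^`(1) -> g \in G -> [~ n, g] \in M.
Proof. by move=> Dn Gg; apply: (subsetP der1_9_comm); apply: mem_commg. Qed.

Lemma Cder_9_cent1 : exists2 n, n \in G^`(1) & 'C_G[n] = Cder G.
Proof.
have [n Dn nMn] : exists2 n, n \in G^`(1) & n \notin M.
  by apply/subsetPn; rewrite -indexg_gt1 iM.
exists n => //; apply/eqP; rewrite eqEsubset; apply/andP; split; last first.
  by rewrite setIS // -cent_set1 centS // sub1set.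
rewrite subsetI subsetIl /= -[X in 'C(X)](prime_indexE sMD _ Dn nMn) ?iM //.
rewrite centY cent_cycle subsetI subsetIr andbT.
apply: subset_trans (subsetIl _ _) _; rewrite centsC.
exact: subset_trans sMZ (subsetIr _ _).
Qed.

(** For n in G' outside M, C_G(n) = C and [n, g] always lies in M, so the class of n has at most 3
    elements. *)
Lemma Cder_9 : #|G : Cder G| = 3.
Proof.
apply/eqP; rewrite eqn_leq (Cder_index_gt2 oddG ncD) andbT.
have [n Dn <-] := Cder_9_cent1; have Gn := subsetP (der_sub 1 G) n Dn.
rewrite index_cent1 -card_commset -oM; apply: subset_leq_card.
by apply/subsetP=> _ /imsetP[g Gg ->]; apply: comm_der1_9.
Qed.

Let W := relZ G M.

Let WP : (exists2 s, 0 < s & #|G : W| = (3 ^ (2 * s))%N)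
  /\ {in G, forall x, x \notin W -> 3 %| #|x ^: G|}.
Proof. exact: relZ_prime (isT : prime 3) nMG sMD iM der1_9_comm. Qed.

(** A smaller class would have size 3, which is already reached modulo M, so commutators of x lying
    in M vanish. For x in C this kills [x, C], giving x in Z(C); otherwise it kills [x, n] with
    C_G(n) = C, giving x in C. *)
Lemma class_9_ge x : x \in G -> x \notin W -> x \notin 'Z(Cder G) -> 9 <= #|x ^: G|.
Proof.
move=> Gx nWx nZx; rewrite leqNgt; apply/negP => lt9.
have c3 : #|x ^: G| = 3.
  have := odd_class x oddG; have := WP.2 x Gx nWx; have : 0 < #|x ^: G|.
    by rewrite -index_cent1 indexg_gt0.
  by move: #|_| lt9 => [|[|[|[|[|[|[|[|[|]]]]]]]]].
have cb3 : 3 <= #|coset M x ^: (G / M)|.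
  apply: class_gt2; first exact: dvdn_odd (dvdn_quotient G M) oddG.
    exact: mem_quotient.
  apply: contra nWx => Zx; rewrite inE (subsetP (normal_norm nMG)) //= inE; exact: Zx.
have inj g : g \in G -> [~ x, g] \in M -> [~ x, g] = 1.
  move=> Gg; apply: (class_quotient_inj nMG Gx Gg); by rewrite c3.
have [Cx|nCx] := boolP (x \in Cder G).
  case/negP: nZx; apply/centerP; split=> // g Cg; apply/commgP/eqP/inj.
    exact: subsetP (Cder_sub G) g Cg.
  rewrite -der1_9_center; apply: subsetP (mem_der1 Cx Cg).
  by rewrite subsetI dergS ?Cder_sub // der1_cent_der1.
have [n Dn eC] := Cder_9_cent1; have Gn := subsetP (der_sub 1 G) n Dn.
case/negP: nCx; rewrite -eC inE Gx; apply/cent1P/commgP/eqP/inj => //.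
by rewrite -invg_comm groupV comm_der1_9.
Qed.

Lemma noncentral_9_abelian : (11%:R / 75%:R <= comm_degree G)%R -> abelian (Cder G).
Proof.
move=> prG; apply: contraT => nC; exfalso; move: prG.
have iC : 9 <= #|Cder G : 'Z(Cder G)|.
  by apply: center_index_Cder; rewrite // der1_9_center.
have iCG : 27 <= #|G : 'Z(Cder G)|.
  by rewrite -(Lagrange_index (Cder_sub G) (center_sub _)) Cder_9 (@leq_pmul2l 3 9).
have iW : 9 <= #|G : W| by have [[s s0 ->] _] := WP; rewrite (@leq_pexp2l 3 2) // leq_pmulr.
have sWG : W \subset G := relZ_sub nMG.
have sZCG : 'Z(Cder G) \subset G := subset_trans (center_sub _) (Cder_sub G).
pose Y := (W :&: 'Z(Cder G))%G.
have sYG : Y \subset G by rewrite subIset // sWG.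
have sZY : 'Z(G) \subset Y.
  apply/subsetIP; split; last first.
    apply/subsetIP; split; first exact: center_Cder.
    exact: subset_trans (subsetIr _ _) (centS (Cder_sub G)).
  apply/subsetP=> x /centerP[Gx cx]; apply/relZP => //; split=> // g /cx/commgP/eqP->.
  exact: group1.
(* Y contains the non-central G', so its index over Z(G) is odd and exceeds 1. *)
have iY : 3 <= #|Y : 'Z(G)|.
  have : odd #|Y : 'Z(G)| by apply: dvdn_odd (dvdn_indexg _ _) (dvdn_odd (cardSg sYG) oddG).
  have : 1 < #|Y : 'Z(G)|.
    rewrite indexg_gt1; apply: contra ncD; apply: subset_trans.
    have aD : abelian G^`(1) by apply: (@card_p2group_abelian _ 3).
    have sDC : G^`(1) \subset Cder G by rewrite subsetI der_sub.
    apply/subsetIP; split; last by apply/subsetIP; split=> //; rewrite centsC subsetIr.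
    apply/subsetP=> n Dn; apply/relZP => //; split; first exact: subsetP (der_sub 1 G) n Dn.
    by move=> g Gg; apply: comm_der1_9.
  by move: #|_ : _| => [|[|[|]]].
have le : (comm_degree G <= mean G (fun x =>
  (9%:R^-1 + (2%:R / 9%:R * mem_ind W x + 2%:R / 9%:R * mem_ind 'Z(Cder G) x))
    + (0 + (- (2%:R / 9%:R) * mem_ind Y x + 2%:R / 3%:R * mem_ind 'Z(G) x))))%R.
  rewrite comm_degreeE; apply: mean_le => x Gx.
  have c0 : 0 < #|x ^: G| by rewrite -index_cent1 indexg_gt0.
  have -> : mem_ind Y x = (((x \in W) && (x \in 'Z(Cder G))) : nat)%:R%R.
    by rewrite /mem_ind inE.
  apply: nine_weight => [/(subsetP sZY)||nZx|nWx nCx].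
  - by rewrite inE.
  - by rewrite -[1%R]invr1 (ler_inv_nat (isT : 0 < 1)).
  - by apply: (ler_inv_nat (isT : 0 < 3)); apply: class_gt2.
  - by apply: (ler_inv_nat (isT : 0 < 9)); apply: class_9_ge.
move/le_trans/(_ le); clear le; rewrite meanD.
rewrite mean_ind2; [ | exact: sWG | exact: sZCG].
rewrite mean_ind2; [ | exact: sYG | exact: center_sub].
move=> h; apply: (nine_arith _ _ _ h); clear h.
- exact: (ler_inv_nat (isT : 0 < 9)).
- exact: (ler_inv_nat (isT : 0 < 27)).
rewrite -(Lagrange_index sYG sZY) natrM invfM mulrCA ger_pMr ?invr_gt0 ?ltr0n ?indexg_gt0 //.
by rewrite ler_pdivrMr ?mul1r ?ler_nat ?ltr0n.
Qed.

(** Elements outside C have order 3 modulo Z(G); comparing the cubes of x and x c gives the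
    exponent. The argument covers a cyclic G' as well. *)
Lemma Cder_9_quotient : abelian (Cder G) -> Cder G / 'Z(G) \isog Elem 3 2.
Proof.
move=> aC; have pC : prime #|G : Cder G| by rewrite Cder_9.
have ncG := nonabelian_noncentral ncD; have nCG := Cder_normal G.
apply: isog_Elem => //; last by rewrite (card_Cder_quotient ncD aC pC) oD.
apply/abelemP => //; split; first exact: quotient_abelian.
move=> _ /morphimP[c Nc Cc ->]; have Gc := subsetP (Cder_sub G) c Cc.
have [x Gx nCx] := exists_out_prime_index pC.
have nZ := subsetP (normal_norm (center_normal G)).
have ord3 y : y \in G -> y \notin Cder G -> coset 'Z(G) y ^+ 3 = 1.
  move=> Gy nCy; have [_] := quotient_center_sdprod nCG aC pC ncG Gy nCy.
  by rewrite Cder_9 => <-; apply: expg_order.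
have nCxc : x * c \notin Cder G by rewrite groupMr.
have commD y g : y \in G^`(1) -> g \in G -> commute (coset 'Z(G) g) (coset 'Z(G) y).
  move=> Dy Gg; have Gy := subsetP (der_sub 1 G) y Dy.
  apply/commute_sym/commgP; rewrite -morphR ?nZ //=; apply/eqP; apply: coset_id.
  exact: subsetP sMZ _ (comm_der1_9 Dy Gg).
have cube y : y \in G^`(1) -> coset 'Z(G) y ^+ 3 = 1.
  move=> Dy; have Gy := subsetP (der_sub 1 G) y Dy.
  rewrite -morphX ?nZ //=; apply: coset_id; apply: (subsetP sMZ).
  have nMy : y \in 'N(M) := subsetP (normal_norm nMG) y Gy.
  apply: coset_idr; first exact: groupX.
  rewrite morphX //= -iM -card_quotient ?expg_cardG ?mem_quotient //.
  exact: subset_trans (der_sub 1 G) (normal_norm nMG).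
(* Modulo Z(G), (x c)^3 = x^3 c^3 [c, x]^3, where the exponent of the commutator is the binomial
   coefficient of 3 over 2. *)
have := ord3 _ (groupM Gx Gc) nCxc; rewrite morphM ?nZ //= expMg_Rmul.
- by rewrite ord3 // mul1g -morphR ?nZ //= (cube _ (mem_der1 Gc Gx)) mulg1.
- by rewrite -morphR ?nZ //=; apply: commD; rewrite // mem_der1.
- by rewrite -morphR ?nZ //=; apply: commD; rewrite // mem_der1.
Qed.

End NoncentralNine.

(** * Derived subgroup of order 15 or 21 *)

Lemma dvdn_index_TI (gT : finGroupType) (D H P : {group gT}) :
  H \subset D -> P <| D -> P :&: H = 1 -> #|P| %| #|D : H|.
Proof.
move=> sHD nPD ti; rewrite -(dvdn_pmul2r (cardG_gt0 H)) -(TI_cardMg ti).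
rewrite [(#|D : H| * _)%N]mulnC Lagrange // -norm_joinEr ?(subset_trans sHD) ?normal_norm //.
by rewrite cardSg // join_subG normal_sub.
Qed.

(** Sylow counting makes P normal. G' centralises P since Aut(P) is abelian, so G' = P M is abelian,
    M is normal in G, and having order 3 it is central. *)
Lemma der1_3q (gT : finGroupType) (G : {group gT}) q : odd #|G| -> (q == 5) || (q == 7) ->
  #|G^`(1)| = (3 * q)%N ->
  exists P M : {group gT}, [/\ P <| G, P \subset G^`(1), #|P| = q &
    [/\ M \subset G^`(1), #|M| = 3, M \subset 'Z(G), P * M = G^`(1) & abelian G^`(1)]].
Proof.
move=> oddG q57 oD; have nDG := der_normal 1 G.
have pq : prime q by case/orP: q57 => /eqP->.
have [P sylP] := Sylow_exists q G^`(1); have [M sylM] := Sylow_exists 3 G^`(1).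
have oP : #|P| = q by rewrite (card_Hall sylP) oD p_part; case/orP: q57 => /eqP->.
have oM : #|M| = 3 by rewrite (card_Hall sylM) oD p_part; case/orP: q57 => /eqP->.
have sPD := pHall_sub sylP; have sMD := pHall_sub sylM.
have nPD : P <| G^`(1).
  have : #|'Syl_q(G^`(1))| == 1%N.
    have := card_Syl_mod G^`(1) pq; have := card_Syl_dvd q G^`(1).
    rewrite oD; case/orP: q57 => /eqP-> d.
      by have := @dvdn_leq _ (3 * 5)%N isT d; move: #|_| d => n; do 16?[case: n => [|n] //].
    by have := @dvdn_leq _ (3 * 7)%N isT d; move: #|_| d => n; do 22?[case: n => [|n] //].
  by rewrite (card_Syl sylP) indexg_eq1 subsetI subxx /normal sPD.
have nPG : P <| G.
  by apply: char_normal_trans nDG; rewrite -(normal_Hall_pcore sylP nPD) pcore_char.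
have cDP := der1_cent_prime (etrans (congr1 prime oP) pq) nPG.
have coPM : coprime #|P| #|M| by rewrite oP oM; case/orP: q57 => /eqP->.
have eD : P * M = G^`(1).
  by apply/eqP; rewrite eqEcard mul_subG //= coprime_cardMg // oP oM oD mulnC.
have aP : abelian P by apply/cyclic_abelian/prime_cyclic; rewrite oP.
have aM : abelian M by apply/cyclic_abelian/prime_cyclic; rewrite oM.
have aD : abelian G^`(1) by rewrite -eD abelianM aP aM /= (subset_trans sMD).
have nMD : M <| G^`(1) by rewrite -sub_abelian_normal.
have nMG : M <| G.
  by apply: char_normal_trans nDG; rewrite -(normal_Hall_pcore sylM nMD) pcore_char.
exists P, M; split=> //; split=> //.
by apply: odd_normal_35_central; rewrite ?oM.
Qed.

Lemma case21_weight (v z c w : bool) (a : rat) : (v -> c) -> (z -> c) -> (a <= 1)%R ->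
    (~~ v -> z -> a <= 3%:R^-1)%R -> (~~ v -> ~~ z -> c -> a <= 9%:R^-1)%R ->
    (~~ c -> a <= 7%:R^-1)%R -> (~~ c -> ~~ w -> a <= 21%:R^-1)%R ->
  (a <= (21%:R^-1 + (1 * (v : nat)%:R + 3%:R^-1 * (z : nat)%:R))
    + (0 + ((9%:R^-1 - 21%:R^-1) * (c : nat)%:R + 7%:R^-1 * (w : nat)%:R)))%R.
Proof.
case: c => /=; last first.
  move=> hv hz _ _ _ h7 h21.
  case: v hv => [hv|_]; first discriminate (hv isT).
  case: z hz => [hz|_]; first discriminate (hz isT).
  by case: w h21 => [_|/(_ isT isT)] /=; [move/(_ isT): h7 | move=> ?]; lra.
move=> _ _ h1 h3 h9 _ _.
have w0 : (0 <= 7%:R^-1 * (w : nat)%:R :> rat)%R by case: (w) => /=; lra.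
move: (_ * (w : nat)%:R)%R w0 => t t0; clear w.
case: v h3 h9 => /= h3 h9; first by clear h3 h9; case: z => /=; lra.
by case: z h3 h9 => /= h3 h9; [move: (h3 isT isT) | move: (h9 isT isT isT)]; lra.
Qed.

(** At the extreme values the right side is 82/567. *)
Lemma case21_arith (v z c w : rat) : (v <= 21%:R^-1)%R -> (z <= 27%:R^-1)%R ->
    (c = 3%:R^-1)%R -> (w <= 9%:R^-1)%R ->
  (11%:R / 75%:R <= (21%:R^-1 + (1 * v + 3%:R^-1 * z))
    + (0 + ((9%:R^-1 - 21%:R^-1) * c + 7%:R^-1 * w)))%R -> False.
Proof. by move=> h1 h2 -> h4; lra. Qed.

(** * Non-central derived subgroup of order 21 *)

Section NoncentralTwentyOne.
Variables (gT : finGroupType) (G P M : {group gT}).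
Hypotheses (oddG : odd #|G|) (ncD : ~~ (G^`(1) \subset 'Z(G))) (oD : #|G^`(1)| = 21).
Hypotheses (nPG : P <| G) (sPD : P \subset G^`(1)) (oP : #|P| = 7).
Hypotheses (sMD : M \subset G^`(1)) (oM : #|M| = 3) (sMZ : M \subset 'Z(G)).
Hypotheses (eD : P * M = G^`(1)) (aD : abelian G^`(1)).

Let sPG : P \subset G := normal_sub nPG.
Let nMG : M <| G := sub_center_normal sMZ.

Lemma Cder_21E : Cder G = 'C_G(P) :> {set gT}.
Proof.
apply/eqP; rewrite eqEsubset; apply/andP; split; first by rewrite setIS // centS.
apply/subsetIP; split; first exact: subsetIl.
rewrite -[X in _ \subset 'C(X)]eD centM subsetI subsetIr /=.
apply: subset_trans (subsetIl _ _) _.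
by rewrite centsC (subset_trans sMZ) // subsetIr.
Qed.

Lemma Cder_21 : #|G : Cder G| = 3.
Proof.
have := index_cent_prime (etrans (congr1 prime oP) isT) nPG.
have := Cder_index_gt2 oddG ncD; have := dvdn_odd (dvdn_indexg G (Cder G)) oddG.
rewrite Cder_21E oP; move: #|_ : _| => i oi i2 di; have := @dvdn_leq _ 6 isT di.
by move: i oi i2 di => [|[|[|[|[|[|[|]]]]]]].
Qed.

Lemma sylow7_noncentral : ~~ (P \subset 'Z(G)).
Proof.
by apply: contra ncD => sPZ; rewrite -eD mul_subG.
Qed.

Lemma sylow7_TI_center : P :&: 'Z(G) = 1.
Proof. by apply: prime_TIg sylow7_noncentral; rewrite oP. Qed.

Lemma der1_21_center : G^`(1) :&: 'Z(G) = M.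
Proof.
by rewrite setIC -eD -group_modr // setIC sylow7_TI_center mul1g.
Qed.

Let W := relZ G P.
Let V := relZ G M.

Let iDP : #|G^`(1) : P| = 3.
Proof. by rewrite -divgS // oD oP. Qed.

Lemma der1_21_comm : [~: G^`(1), G] \subset P.
Proof.
have nP := normal_norm nPG; have nPD := subset_trans (der_sub 1 G) nP.
rewrite -quotient_cents2 //; apply: subset_trans (subsetIr (G / P) _).
apply: odd_normal_35_central; first exact: dvdn_odd (dvdn_quotient G P) oddG.
  exact: quotient_normal (der_normal 1 G).
by rewrite card_quotient // iDP.
Qed.

Let WP : (exists2 s, 0 < s & #|G : W| = (3 ^ (2 * s))%N)
  /\ {in G, forall x, x \notin W -> 3 %| #|x ^: G|}.
Proof. exact: relZ_prime (isT : prime 3) nPG sPD iDP der1_21_comm. Qed.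

Lemma V_sub_Cder : V \subset Cder G.
Proof. exact: relZ_cent_der1. Qed.

Lemma index_V_21 : 21 <= #|G : V|.
Proof.
rewrite -(Lagrange_index (Cder_sub G) V_sub_Cder) Cder_21 (@leq_pmul2l 3 7) // -oP.
apply: leq_index_TI; first exact: V_sub_Cder.
  by rewrite subsetI sPG (subset_trans sPD).
(* If P lay in V, commutators of P with G would lie in both P and M, hence vanish, making P
   central. *)
apply: prime_TIg; rewrite ?oP //; apply: contra sylow7_noncentral => sPV.
apply/subsetP=> x Px; apply/centerP; split; first exact: subsetP sPG x Px.
have /(relZP _ nMG)[Gx cx] := subsetP sPV x Px.
move=> g Gg; apply/commgP; rewrite -in_set1 -[[set 1]]/(1 : {set gT}).
have <- : P :&: M = 1 by apply: coprime_TIg; rewrite oP oM.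
rewrite inE cx // andbT; apply: (subsetP der1_21_comm); apply: mem_commg => //.
exact: subsetP sPD x Px.
Qed.

(** C_G(x) lies in C, so the class size is 3 times |C : C_G(x)|, an odd number above 1. *)
Lemma class21_in x : x \in Cder G -> x \notin V -> x \notin 'Z(Cder G) -> 9 <= #|x ^: G|.
Proof.
move=> Cx nVx nZx; have Gx := subsetP (Cder_sub G) x Cx.
have nM := normal_norm nMG.
(* If some h outside C commuted with x, then C and h would generate G. Both commute with x modulo M,
   since C' lies in M, so x would be in V. *)
have sC : 'C_G[x] \subset Cder G.
  apply/subsetP=> h /setIP[Gh /cent1P cxh]; apply: contraR nVx => nCh.
  have sGK : G \subset coset M @*^-1 'C[coset M x].
    rewrite -(prime_indexE (Cder_sub G) _ Gh nCh) ?Cder_21 // join_subG cycle_subG.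
    apply/andP; split; last first.
      rewrite inE (subsetP nM) //= inE; apply/cent1P/commgP.
      by rewrite -morphR ?(subsetP nM) //= (eqP (introT commgP cxh)) morph1.
    apply/subsetP=> c Cc; have Gc := subsetP (Cder_sub G) c Cc.
    rewrite inE (subsetP nM) //= inE; apply/cent1P/commgP.
    rewrite -morphR ?(subsetP nM) //=; apply/eqP; apply: coset_id.
    rewrite -der1_21_center; apply: subsetP (mem_der1 Cc Cx).
    by rewrite subsetI dergS ?Cder_sub // der1_cent_der1.
  apply/(relZP _ nMG); split=> // g Gg; apply: coset_idr; first by rewrite groupR ?(subsetP nM).
  rewrite morphR ?(subsetP nM) //; apply/eqP/commgP/commute_sym.
  by have /morphpreP[_ /cent1P] := subsetP sGK g Gg.
rewrite -index_cent1 -(Lagrange_index (Cder_sub G) sC) Cder_21 (@leq_pmul2l 3 3) //.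
have : odd #|Cder G : 'C_G[x]|.
  by apply: dvdn_odd (dvdn_indexg _ _) (dvdn_odd (cardSg (Cder_sub G)) oddG).
have : 1 < #|Cder G : 'C_G[x]|.
  rewrite indexg_gt1; apply: contra nZx => sCC; apply/centerP; split=> // g Cg.
  by have /setIP[_ /cent1P] := subsetP sCC g Cg.
by move: #|_ : _| => [|[|[|]]].
Qed.

Lemma class21_out x : x \in G -> x \notin Cder G -> 7 %| #|x ^: G|.
Proof.
move=> Gx nCx; rewrite -index_cent1 -oP; apply: dvdn_index_TI; rewrite ?subsetIl //.
apply: prime_TIg; rewrite ?oP //; apply: contra nCx => sPC.
by rewrite Cder_21E inE Gx -sub_cent1 (subset_trans sPC) // subsetIr.
Qed.

Lemma noncentral_21_abelian : (11%:R / 75%:R <= comm_degree G)%R -> abelian (Cder G).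
Proof.
move=> prG; apply: contraT => nC; exfalso; move: prG.
have iC : 9 <= #|Cder G : 'Z(Cder G)|.
  by apply: center_index_Cder; rewrite // der1_21_center.
have iCG : 27 <= #|G : 'Z(Cder G)|.
  by rewrite -(Lagrange_index (Cder_sub G) (center_sub _)) Cder_21 (@leq_pmul2l 3 9).
have iW : 9 <= #|G : W| by have [[s s0 ->] _] := WP; rewrite (@leq_pexp2l 3 2) // leq_pmulr.
have sWG : W \subset G := relZ_sub nPG.
have sVG : V \subset G := relZ_sub nMG.
have sZCG : 'Z(Cder G) \subset G := subset_trans (center_sub _) (Cder_sub G).
have le : (comm_degree G <= mean G (fun x =>
  (21%:R^-1 + (1 * mem_ind V x + 3%:R^-1 * mem_ind 'Z(Cder G) x))
    + (0 + ((9%:R^-1 - 21%:R^-1) * mem_ind (Cder G) x + 7%:R^-1 * mem_ind W x))))%R.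
  rewrite comm_degreeE; apply: mean_le => x Gx.
  have c0 : 0 < #|x ^: G| by rewrite -index_cent1 indexg_gt0.
  apply: case21_weight => [||| nVx Zx | nVx nZx Cx | nCx | nCx nWx].
  - exact: subsetP V_sub_Cder x.
  - exact: subsetP (center_sub _) x.
  - by rewrite -[1%R]invr1 (ler_inv_nat (isT : 0 < 1)).
  - apply: (ler_inv_nat (isT : 0 < 3)); apply: class_gt2 => //.
    apply: contra nVx => /centerP[_ cx]; apply/relZP => //; split=> // g /cx/commgP/eqP->.
    exact: group1.
  - by apply: (ler_inv_nat (isT : 0 < 9)); apply: class21_in.
  - by apply: (ler_inv_nat (isT : 0 < 7)); rewrite dvdn_leq // class21_out.
  - apply: (ler_inv_nat (isT : 0 < 21)); rewrite dvdn_leq //.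
    by rewrite (@Gauss_dvd 3 7) // class21_out // WP.2.
move/le_trans/(_ le); clear le; rewrite meanD.
rewrite mean_ind2; [ | exact: sVG | exact: sZCG].
rewrite mean_ind2; [ | exact: Cder_sub | exact: sWG].
move=> h; apply: (case21_arith _ _ _ _ h); clear h.
- exact: (ler_inv_nat (isT : 0 < 21) index_V_21).
- exact: (ler_inv_nat (isT : 0 < 27)).
- by rewrite Cder_21.
- exact: (ler_inv_nat (isT : 0 < 9)).
Qed.

(** C / Z(G) is abelian of order 21. Its Sylow 3-subgroup K is normal of order 3 in an odd group,
    hence central, and splits off; its Sylow 7-subgroup with the image of x forms the other
    factor. *)
Lemma structure_21 : abelian (Cder G) -> is_C3_x_C7sdC3 (G / 'Z(G)).
Proof.
move=> aC; have pC : prime #|G : Cder G| by rewrite Cder_21.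
have ncG := nonabelian_noncentral ncD; have nCG := Cder_normal G.
have [x Gx nCx] := exists_out_prime_index pC.
have [eQ ox] := quotient_center_sdprod nCG aC pC ncG Gx nCx.
pose Q := (G / 'Z(G))%G; pose Cb := (Cder G / 'Z(G))%G; pose X := <[coset 'Z(G) x]>%G.
rewrite Cder_21 in ox; have oX : #|X| = 3 by [].
have oCb : #|Cb| = 21 by rewrite (card_Cder_quotient ncD aC pC) oD.
have aCb : abelian Cb := quotient_abelian _ aC.
have nCbQ : Cb <| Q := quotient_normal _ nCG.
have oddQ : odd #|Q| := dvdn_odd (dvdn_quotient G 'Z(G)%G) oddG.
have [R sylR] := Sylow_exists 7 Cb; have [K sylK] := Sylow_exists 3 Cb.
have oR : #|R| = 7 by rewrite (card_Hall sylR) oCb p_part.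
have oK : #|K| = 3 by rewrite (card_Hall sylK) oCb p_part.
have sRC := pHall_sub sylR; have sKC := pHall_sub sylK.
have nRC : R <| Cb by rewrite -sub_abelian_normal.
have nKC : K <| Cb by rewrite -sub_abelian_normal.
have nRQ : R <| Q.
  apply: char_normal_trans nCbQ.
  by rewrite -(normal_Hall_pcore sylR nRC) pcore_char.
have nKQ : K <| Q.
  apply: char_normal_trans nCbQ.
  by rewrite -(normal_Hall_pcore sylK nKC) pcore_char.
have sKZ : K \subset 'Z(Q) by apply: odd_normal_35_central; rewrite ?oK.
have cRK : R * K = Cb.
  apply/eqP; rewrite eqEcard mul_subG //= coprime_cardMg ?oR ?oK //.
  by rewrite [X in X <= _]oCb.
have sXQ : X \subset Q by rewrite cycle_subG mem_quotient.
have sRQ := normal_sub nRQ.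
have nRX : X \subset 'N(R) := subset_trans sXQ (normal_norm nRQ).
have tRX : R :&: X = 1 by apply: coprime_TIg; rewrite oR oX.
have eL : R ><| X = R <*> X by rewrite sdprodEY.
pose L := (R <*> X)%G; have oL : #|L| = 21 by rewrite -(sdprod_card eL) oR oX.
have sLQ : L \subset Q by rewrite join_subG sRQ.
have cKL : L \subset 'C(K).
  by rewrite centsC (subset_trans sKZ) // (subset_trans (subsetIr _ _)) // centS.
have eKL : K * L = Q.
  have sCbL : Cb \subset K <*> L.
    rewrite -[Cb : {set _}]cRK mul_subG ?joing_subl //.
    by rewrite (subset_trans _ (joing_subr _ _)) // joing_subl.
  have : Cb * X \subset K <*> L.
    by rewrite mul_subG // (subset_trans _ (joing_subr _ _)) // joing_subr.
  rewrite (sdprodW eQ) -cent_joinEr // => sQ.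
  by apply/eqP; rewrite eqEsubset join_subG (normal_sub nKQ) sLQ.
have oQ : #|Q| = 63 by rewrite -(sdprod_card eQ) oCb oX.
have tKL : K :&: L = 1.
  apply/eqP; rewrite trivg_card1; have := mul_cardG K L; rewrite eKL oK oL oQ.
  by move/eqP; rewrite (@eqn_pmul2l 63 1) // eq_sym.
exists K, L; split; first by rewrite dprodE.
  exact: isog_Cyc_prime.
exists R, X; split=> //; [exact: isog_Cyc_prime | exact: isog_Cyc_prime |].
apply: contra (quotient_center_nonabelian ncD) => aL.
rewrite -[X in abelian X]eKL abelianM; apply/and3P; split=> //.
exact: abelianS sKC aCb.
Qed.

End NoncentralTwentyOne.

(** * The classification *)

Lemma odd_le25_cases n : odd n -> n <= 25 ->
  prime n \/ (n \in [:: 1; 9; 15; 21; 25]%N).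
Proof.
move=> on le; apply/orP; have := on.
have /allP/(_ n) : all (fun n => odd n ==> prime n || (n \in [:: 1; 9; 15; 21; 25]%N)) (iota 0 26).
  by vm_compute.
by rewrite mem_iota => /(_ le) /implyP.
Qed.

Lemma central_prime7_arith (z : rat) : (z <= 2401%:R^-1)%R ->
  (11%:R / 75%:R <= 7%:R^-1 + (1 - 7%:R^-1) * z)%R -> False.
Proof. lra. Qed.

(** Dropping the nonnegative product a z leaves a linear problem: a + z is at most 12/121. *)
Lemma central_prime11_arith (a z : rat) : (0 <= a)%R -> (a <= 11%:R^-1)%R -> (0 <= z)%R ->
  (z <= 121%:R^-1)%R -> (11%:R / 75%:R <= a + (1 - a) * z)%R -> False.
Proof.
move=> a0 a1 z0 z1; rewrite mulrBl mul1r; have := mulr_ge0 a0 z0.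
by move: (a * z)%R => t; lra.
Qed.

Lemma central_15_arith : (11%:R / 75%:R <=
  (3 * 5)%:R^-1 + (5%:R^-1 / 9%:R + 5%:R^-1 / 5%:R) :> rat)%R -> False.
Proof. by rewrite natrM; lra. Qed.

Lemma central_21_arith : (11%:R / 75%:R <=
  (3 * 7)%:R^-1 + (7%:R^-1 / 9%:R + 7%:R^-1 / 7%:R) :> rat)%R -> False.
Proof. by rewrite natrM; lra. Qed.

Lemma value_central3 (w : rat) : (3%:R^-1 + (1 - 3%:R^-1) * w = 1 / 3%:R * (1 + 2%:R * w))%R.
Proof. by field. Qed.

Lemma value_central5 (w : rat) : (5%:R^-1 + (1 - 5%:R^-1) * w = 1 / 5%:R * (1 + 4%:R * w))%R.
Proof. by field. Qed.

Lemma value_central7 : (7%:R^-1 + (1 - 7%:R^-1) / 49%:R = 55%:R / 343%:R :> rat)%R.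
Proof. by field. Qed.

Lemma value_7 : (9%:R^-1 + 8%:R / 9%:R / 7%:R = 5%:R / 21%:R :> rat)%R.
Proof. by field. Qed.

Lemma value_9 : (9%:R^-1 + 8%:R / 9%:R / 9%:R = 17%:R / 81%:R :> rat)%R.
Proof. by field. Qed.

Lemma value_13 : (9%:R^-1 + 8%:R / 9%:R / 13%:R = 7%:R / 39%:R :> rat)%R.
Proof. by field. Qed.

Lemma value_19 : (9%:R^-1 + 8%:R / 9%:R / 19%:R = 3%:R / 19%:R :> rat)%R.
Proof. by field. Qed.

Lemma value_21 : (9%:R^-1 + 8%:R / 9%:R / 21%:R = 29%:R / 189%:R :> rat)%R.
Proof. by field. Qed.

Lemma value_25 : (9%:R^-1 + 8%:R / 9%:R / 25%:R = 11%:R / 75%:R :> rat)%R.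
Proof. by field. Qed.

Lemma central_prime_cases (gT : finGroupType) (G : {group gT}) :
    odd #|G| -> G^`(1) \subset 'Z(G) -> prime #|G^`(1)| ->
    (11%:R / 75%:R <= comm_degree G)%R ->
  #|G^`(1)| \in [:: 3; 5] \/ #|G^`(1)| = 7 /\ #|G : 'Z(G)| = 49.
Proof.
move=> oddG cD; move Dp: #|G^`(1)| => p pD.
have [s s0 es] := index_center_prime pD Dp cD.
rewrite (comm_degree_central_prime cD pD Dp) es.
have op : odd p by rewrite -Dp; apply: dvdn_odd (cardSg (der_sub 1 G)) oddG.
have [le10|gt10] := leqP p 10.
  have : p \in [:: 3; 5; 7].
    by move: p pD op le10 {es Dp} => n; do 11?[case: n => [|n] //].
  rewrite !inE; case/or3P => /eqP ep; [by left; rewrite ep | by left; rewrite ep |].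
  rewrite ep; rewrite ep in es; case: s s0 es => [s0|[|s]] _ es; first discriminate s0.
    by move=> _; right.
  move=> h; exfalso.
  case: (central_prime7_arith _ h); clear h; apply: (ler_inv_nat (isT : 0 < 2401)).
  by rewrite (@leq_pexp2l 7 4) // !mulnS.
move=> h; case: (central_prime11_arith _ _ _ _ h); clear h.
- by rewrite invr_ge0 ler0n.
- exact: (ler_inv_nat (isT : 0 < 11)).
- by rewrite invr_ge0 ler0n.
apply: (ler_inv_nat (isT : 0 < 121)); apply: leq_trans (_ : p ^ 2 <= _).
  by rewrite (@leq_exp2r 11 p 2).
by apply: leq_pexp2l; rewrite ?prime_gt0 // leq_pmulr.
Qed.

Lemma central_3q_exclude (gT : finGroupType) (G : {group gT}) :
    odd #|G| -> G^`(1) \subset 'Z(G) -> #|G^`(1)| \in [:: 15; 21] ->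
    (11%:R / 75%:R <= comm_degree G)%R -> False.
Proof.
move=> oddG cD; rewrite !inE => /orP[]/eqP oD.
  have [P [M [_ sPD oP [sMD oM _ _ _]]]] := der1_3q (q := 5) oddG isT oD.
  have le := central_3q_bound cD (isT : prime 5) isT oD sPD oP sMD oM.
  by move/le_trans/(_ le) => /central_15_arith.
have [P [M [_ sPD oP [sMD oM _ _ _]]]] := der1_3q (q := 7) oddG isT oD.
have le := central_3q_bound cD (isT : prime 7) isT oD sPD oP sMD oM.
by move/le_trans/(_ le) => /central_21_arith.
Qed.

Lemma noncentral_15_exclude (gT : finGroupType) (G : {group gT}) :
    odd #|G| -> ~~ (G^`(1) \subset 'Z(G)) -> #|G^`(1)| = 15 -> False.
Proof.
move=> oddG ncD oD.
have [P [M [nPG sPD oP [sMD oM sMZ eD _]]]] := der1_3q (q := 5) oddG isT oD.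
case/negP: ncD; rewrite -eD mul_subG //; apply: odd_normal_35_central; rewrite ?oP //.
Qed.

(** G' embeds in C / Z(G), which has the same order. *)
Lemma isog_TI_quotient_center (gT : finGroupType) (G : {group gT}) :
    abelian (Cder G) -> prime #|G : Cder G| -> ~~ (G^`(1) \subset 'Z(G)) ->
    abelian G^`(1) -> G^`(1) :&: 'Z(G) = 1 ->
  G^`(1) \isog Cder G / 'Z(G).
Proof.
move=> aC pC ncD aD ti.
have nZ := subset_trans (der_sub 1 G) (normal_norm (center_normal G)).
have isoD : G^`(1) \isog G^`(1) / 'Z(G).
  apply: quotient_isog => //; by rewrite setIC.
suff -> : Cder G / 'Z(G) = G^`(1) / 'Z(G) by [].
apply/esym/eqP; rewrite eqEcard quotientS ?subsetI ?der_sub //=.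
by rewrite (card_Cder_quotient ncD aC pC) (card_isog isoD).
Qed.

Unset Implicit Arguments.

Theorem theorem4p3 (gT : finGroupType) (G : {group gT}) :
  odd #|G| ->
  (11%:R / 75%:R <= comm_degree G)%R ->
  let P := comm_degree G in
  let D := [~: G, G] in
  let DZ := D :&: 'Z(G) in
  let Q := G / 'Z(G) in
  [\/ (* (1) *)
      [/\ P = 1%R, D :=: 1, DZ :=: 1 & Q :=: 1],
      (* (2) *)
      (exists2 s : nat, (1 <= s)%N &
        [/\ P = (1 / 3%:R * (1 + 2%:R / 3%:R ^+ (2 * s)))%R,
            D \isog Cyc 3, DZ \isog Cyc 3 & Q \isog Elem 3 (2 * s)]) |
  [\/ (* (3) *)
      (exists2 s : nat, (1 <= s)%N &
        [/\ P = (1 / 5%:R * (1 + 4%:R / 5%:R ^+ (2 * s)))%R,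
            D \isog Cyc 5, DZ \isog Cyc 5 & Q \isog Elem 5 (2 * s)]),
      (* (4) *)
      [/\ P = (5%:R / 21%:R)%R, D \isog Cyc 7, DZ :=: 1
        & is_nonab_sdprod Q (Cyc 7) (Cyc 3)] |
  [\/ (* (5) *)
      [/\ P = (55%:R / 343%:R)%R, D \isog Cyc 7, DZ \isog Cyc 7
        & Q \isog Elem 7 2],
      (* (6) *)
      [/\ P = (17%:R / 81%:R)%R, (D \isog Cyc 9 \/ D \isog Elem 3 2),
          DZ \isog Cyc 3 & is_nonab_sdprod Q (Elem 3 2) (Cyc 3)] |
  [\/ (* (7) *)
      [/\ P = (17%:R / 81%:R)%R, D \isog Elem 3 2, DZ \isog Elem 3 2
        & Q \isog Elem 3 3],
      (* (8) *)
      [/\ P = (121%:R / 729%:R)%R, D \isog Elem 3 2, DZ \isog Elem 3 2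
        & Q \isog Elem 3 4] |
  [\/ (* (9) *)
      [/\ P = (7%:R / 39%:R)%R, D \isog Cyc 13, DZ :=: 1
        & is_nonab_sdprod Q (Cyc 13) (Cyc 3)],
      (* (10) *)
      [/\ P = (3%:R / 19%:R)%R, D \isog Cyc 19, DZ :=: 1
        & is_nonab_sdprod Q (Cyc 19) (Cyc 3)],
      (* (11) *)
      [/\ P = (29%:R / 189%:R)%R, D \isog Cyc 21, DZ \isog Cyc 3
        & is_C3_x_C7sdC3 Q] |
      (* (12) *)
      [/\ P = (11%:R / 75%:R)%R, D \isog Elem 5 2, DZ :=: 1
        & is_nonab_sdprod Q (Elem 5 2) (Cyc 3)]]]]]].
Proof.
move=> oddG prG /=; rewrite -derg1; move: prG.
have oddD : odd #|G^`(1)| := dvdn_odd (cardSg (der_sub 1 G)) oddG.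
have [cD|ncD] := boolP (G^`(1) \subset 'Z(G)).
  have eDZ := setIidPl cD; rewrite eDZ.
  move=> prG; have [pD|cases] := odd_le25_cases oddD (der1_le25 oddG prG).
    have := central_prime_cases oddG cD pD prG; clear prG.
    have [s s0 [es isoD _ isoQ]] := structure_central_prime cD pD (erefl _).
    have eP := comm_degree_central_prime cD pD (erefl _).
    case=> [|[e7 e49]].
      rewrite !inE => /orP[] /eqP ep; rewrite ep in es isoD isoQ eP.
        apply: Or32; exists s; [exact: s0 | split; [| exact: isoD | exact: isoD | exact: isoQ]].
        by rewrite eP es natrX; apply: value_central3.
      apply: Or33; apply: Or31; exists s; [exact: s0 | split; [| exact: isoD | exact: isoD | exact: isoQ]].
      by rewrite eP es natrX; apply: value_central5.
    have e2 : (2 * s)%N = 2 by move/eqP: es; rewrite e7 e49 (@eqn_exp2l 7 2) // => /eqP.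
    rewrite e7 e2 in isoD isoQ; rewrite e7 e49 in eP; do 2![apply: Or33]; apply: Or31.
    by split; [rewrite eP; apply: value_central7 | exact: isoD | exact: isoD | exact: isoQ].
  move: prG; move: cases; rewrite !inE; case/or4P => [/eqP o1|/eqP o9|/eqP o15|/orP[]/eqP o2].
  - move=> _; have D1 : G^`(1) = 1 by apply: card1_trivg.
    have aG : abelian G by apply/derG1P.
    apply: Or31; split=> //; last by rewrite (center_idP aG) trivg_quotient.
    move: aG; rewrite card_classes_abelian comm_degree_classes => /eqP->.
    by rewrite divff // cardG_rat_neq0.
  - have [cycD|nc] := boolP (cyclic G^`(1)).
      move=> prG; have := central9_cyclic_bound cD o9 cycD.
      by rewrite ltNge prG.
    have aD := abelem_or_cyclic_p2 (isT : prime 3) o9 nc.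
    have isoD : G^`(1) \isog Elem 3 2 by apply: isog_Elem.
    move=> prG; have := central9_elem cD o9 aD prG; clear prG => -[] [eP isoQ].
      by do 3![apply: Or33]; apply: Or31; split; [exact: eP | exact: isoD | exact: isoD | exact: isoQ].
    by do 3![apply: Or33]; apply: Or32; split; [exact: eP | exact: isoD | exact: isoD | exact: isoQ].
  - by move=> prG; case: (central_3q_exclude oddG cD _ prG); rewrite o15.
  - by move=> prG; case: (central_3q_exclude oddG cD _ prG); rewrite o2.
  (* Order 25 forces G' to meet Z(G) trivially, which a central G' cannot do. *)
  - move=> prG; have := der1_25_TI oddG o2 (fun i => irrdeg_le3 i oddG o2 prG); clear prG.
    by rewrite eDZ => D1; rewrite D1 cards1 in o2.
move=> prG; have [pD|cases] := odd_le25_cases oddD (der1_le25 oddG prG).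
  have := noncentral_prime oddG ncD pD (der1_le25 oddG prG) prG; clear prG.
  case=> iC aC; have eP := comm_degree_Cder ncD aC iC.
  have ti := der1_TI_center_prime ncD pD; rewrite ti.
  have isoD : G^`(1) \isog Cyc #|G^`(1)| by apply: isog_Cyc_prime.
  have pC : prime #|G : Cder G| by rewrite iC.
  have isoQ : is_nonab_sdprod (G / 'Z(G)) (Cyc #|G^`(1)|) (Cyc 3).
    apply: sdprod_Cder => //; apply: isog_Cyc_prime => //.
    exact: card_Cder_quotient.
  rewrite !inE => /or3P[] /eqP ep; rewrite ep in eP isoD isoQ.
  - by apply: Or33; apply: Or32; split; [rewrite eP; apply: value_7 | exact: isoD | | exact: isoQ].
  - do 4![apply: Or33]; apply: Or41.
    by split; [rewrite eP; apply: value_13 | exact: isoD | | exact: isoQ].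
  - do 4![apply: Or33]; apply: Or42.
    by split; [rewrite eP; apply: value_19 | exact: isoD | | exact: isoQ].
move: prG; move: cases; rewrite !inE; case/or4P => [/eqP o1|/eqP o9|/eqP o15|/orP[]/eqP o2].
- by case/negP: ncD; rewrite (card1_trivg o1) sub1G.
- have [M [nMG sMD oM]] := der1_9_line oddG o9.
  move/(noncentral_9_abelian oddG ncD o9 nMG sMD oM) => aC.
  have iC := Cder_9 oddG ncD o9 nMG sMD oM.
  do 2![apply: Or33]; apply: Or32; split.
  + by rewrite (comm_degree_Cder ncD aC iC) o9; apply: value_9.
  + have [cycD|nc] := boolP (cyclic G^`(1)); first by left; apply: isog_Cyc.
    by right; apply: isog_Elem; rewrite ?abelem_or_cyclic_p2.
  + by rewrite (der1_9_center oddG ncD o9 nMG sMD oM); apply: isog_Cyc_prime.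
  by apply: sdprod_Cder => //; apply: (Cder_9_quotient oddG ncD o9 nMG sMD oM).
- by case: (noncentral_15_exclude oddG ncD o15).
- have [P [M [nPG sPD oP [sMD oM sMZ eD aD]]]] := der1_3q (q := 7) oddG isT o2.
  move/(noncentral_21_abelian oddG ncD o2 nPG sPD oP oM sMZ eD aD) => aC.
  have iC := Cder_21 oddG ncD nPG sPD oP sMZ eD.
  do 4![apply: Or33]; apply: Or43; split.
  + by rewrite (comm_degree_Cder ncD aC iC) o2; apply: value_21.
  + apply: isog_Cyc => //.
    have cMP : M \subset 'C(P) by rewrite (subset_trans sMD) // (subset_trans aD) // centS.
    have := cyclicM (prime_cyclic _) (prime_cyclic _) cMP; rewrite eD.
    by apply; rewrite ?oP ?oM.
  + by rewrite (der1_21_center ncD oP sMZ eD); apply: isog_Cyc_prime.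
  by apply: (structure_21 oddG ncD o2 nPG sPD oP sMZ eD).
- move=> prG; have irr3 i := irrdeg_le3 i oddG o2 prG; clear prG.
  have iC := Cder_25 oddG o2 irr3; have ti := der1_25_TI oddG o2 irr3.
  have aD5 := der1_25_abelem oddG o2 irr3; have aC := Cder_abelian_TI ti.
  have isoD : G^`(1) \isog Elem 5 2 by apply: isog_Elem.
  have pC : prime #|G : Cder G| by rewrite iC.
  do 4![apply: Or33]; apply: Or44; rewrite ti; split.
  + by rewrite (comm_degree_Cder ncD aC iC) o2; apply: value_25.
  + exact: isoD.
  + by [].
  apply: sdprod_Cder => //; apply: isog_trans isoD; rewrite isog_sym.
  exact: isog_TI_quotient_center (abelem_abelian aD5) ti.
Qed.
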